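(* Let $L>0$, $\beta>0$ and $$A_2=\Big\{b\in L^1_{\rm loc}(\mathbb{R})\ \Big|\ b(\cdot+L)=b(\cdot),\ b\ge 0,\ \frac1L\int_0^L b^2\,dx=\beta\Big\}.$$ Let $b$ be a maximizer of $c^*$ in $A_2$. Then $b$ satisfies the Euler--Lagrange equation $$b''+4k\,b+3b^2=C\quad (x\in\mathbb{R}/L\mathbb{Z}),\qquad C=3\beta+\frac{4k}{L}\int_0^L b\,dx,\qquad k=k(\lambda(b),b).$$
   Context: For $\lambda\in\mathbb{R}$ and a real $L$-periodic function $b\in L^1_{\rm loc}(\mathbb{R})$, $k(\lambda,b)\in\mathbb{R}$ denotes the principal eigenvalue of $-L_{\lambda,b}\psi:=-\psi''-2\lambda\psi'-(b(x)+\lambda^2)\psi$ on $\mathbb{R}/L\mathbb{Z}$, i.e. the unique real number for which $-L_{\lambda,b}\psi=k(\lambda,b)\psi$ has an $L$-periodic positive solution $\psi$. For $b\ge0$, $b\not\equiv0$, the minimal speed of pulsating traveling waves of $u_t=u_{xx}+b(x)(1-u)u$ is $c^*(b)=\min_{\lambda>0}\frac{-k(\lambda,b)}{\lambda}$, and $\lambda(b)>0$ denotes the unique $\lambda>0$ at which this minimum is attained. Functions are identified when equal almost everywhere (so the conclusion is about a representative of $b$). *)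

(* Defs.v *)
From HB Require Import structures.
From mathcomp Require Export all_boot all_order all_algebra.
From mathcomp Require Export all_classical all_reals all_analysis.

Set Implicit Arguments.
Unset Strict Implicit.
Unset Printing Implicit Defensive.

Export Order.TTheory GRing.Theory Num.Theory.
Export numFieldNormedType.Exports.

Local Open Scope classical_set_scope.
Local Open Scope ring_scope.

Section PulsatingWaves.
Context {R : realType}.
Implicit Types (L lambda k beta : R) (b f g psi : R -> R).

Local Notation mu := (@lebesgue_measure R).

(* g is the L^1_loc derivative of f, i.e. f is in W^{1,1}_loc with f' = g
   (f being the locally absolutely continuous representative). *)
Definition is_L1loc_derivative f g : Prop :=
  locally_integrable setT g /\
  forall x y, x <= y -> f y - f x = \int[mu]_(t in `[x, y]) g t.

(* As b is only L^1_loc, solutions are taken in W^{2,1}_loc: psi is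
   differentiable everywhere, psi'' is the L^1_loc derivative of psi', and the
   equation holds almost everywhere. *)
Definition is_principal_eigenvalue L lambda b k : Prop :=
  exists psi psi'' : R -> R,
    [/\ periodic psi L,
        forall x, 0 < psi x,
        forall x, derivable psi x 1,
        is_L1loc_derivative (derive1 psi) psi'' &
        {ae mu, forall x,
          - psi'' x - 2 * lambda * derive1 psi x - (b x + lambda ^+ 2) * psi x
          = k * psi x}].

(* xget is a definite description here: it returns the eigenvalue, which
   exists and is unique for L > 0 and L-periodic b in L^1_loc. Likewise in
   minimal_speed and optimal_lambda, for b >= 0 not a.e. zero. The default
   value 0 is irrelevant. *)
Definition principal_eigenvalue L lambda b : R :=
  xget 0 [set k | is_principal_eigenvalue L lambda b k].

Definition speeds L b : set R :=
  [set - principal_eigenvalue L lambda b / lambda | lambda in [set l | 0 < l]].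

Definition minimal_speed L b : R :=
  xget 0 (speeds L b `&` lbound (speeds L b)).

Definition optimal_lambda L b : R :=
  xget 0 [set lambda | 0 < lambda /\
    - principal_eigenvalue L lambda b / lambda = minimal_speed L b].

(* Functions are identified when equal a.e., so periodicity and nonnegativity
   are a.e. conditions. The integral of b^2 is extended-real valued: the
   constraint includes its finiteness. *)
Definition A2 L beta : set (R -> R) :=
  [set b | [/\ locally_integrable setT b,
               {ae mu, forall x, b (x + L) = b x},
               {ae mu, forall x, 0 <= b x} &
               ((L^-1)%:E * \int[mu]_(x in `[0%R, L]) ((b x) ^+ 2)%:E)%E
               = beta%:E]].

Definition is_maximizer_A2 L beta b : Prop :=
  A2 L beta b /\
  forall b', A2 L beta b' -> minimal_speed L b' <= minimal_speed L b.

End PulsatingWaves.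

(* Main.v *)
From mathcomp Require Import ring lra measurable_realfun.
Require Import Defs.

(* With mu = - k and phi = e^(lambda x) psi, the eigenvalue equation is
   phi'' + b phi = mu phi, so v = phi' / phi = psi' / psi + lambda is a periodic
   solution of the Riccati equation v' = mu - b - v^2 with mean lambda.  Let p be
   the positive periodic solution of p' = 2 v p - 1 (the product of psi and the
   adjoint eigenfunction).  If (mu^, lambda^, v^) belongs to another potential b^,
   integrating the difference of the two Riccati equations against p gives
     int (b^ - b) p = (mu^ - mu) int p - (lambda^ - lambda) L - int (v^ - v)^2 p.
   With b^ = b and lambda^ near the minimizer of mu / lambda, this yields the
   first-order condition c int p = L, where c is the minimal speed; hence
   int (b^ - b) p <= 0 for every competitor b^ whose minimal speed is at most c.
   Taking b^ = t p with the normalization of A2, the equality case of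
   Cauchy-Schwarz forces b = t p a.e., and the Euler-Lagrange equation is the
   first integral of the system satisfied by p and v.

   Maximality makes the minimal speed of b positive, so none of the junk values 0
   in the definitions occurs and b has a principal eigenvalue for every lambda > 0.
   Existence therefore has to be proved only for continuous positive potentials
   (constants and t p): the inverse of a constant-coefficient operator contracts
   the oscillation of ratios of positive functions, which gives a Perron
   eigenfunction, and the intermediate value theorem fixes the eigenvalue. *)

Set Implicit Arguments.
Unset Strict Implicit.
Unset Printing Implicit Defensive.

Local Open Scope classical_set_scope.
Local Open Scope ring_scope.

(** * Primitives of continuous functions *)

(* Alias on which [continuity] can match syntactically: unifying against [continuous]
   unfolds the ring operations and is very slow. *)
Definition continuous_alias {R : realType} (f : R -> R) := continuous f.

Lemma continuous_alias_elim {R : realType} (f : R -> R) : continuous_alias f -> continuous f.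
Proof. by []. Qed.

Section calculus.
Context {R : realType}.
Implicit Types (f g h F : R -> R) (a b c x y L : R).

Local Notation mu := (@lebesgue_measure R).

Lemma continuous_funD f g : continuous f -> continuous g -> continuous (fun x => f x + g x).
Proof. by move=> cf cg x; apply: cvgD; [exact: cf|exact: cg]. Qed.

Lemma continuous_funN f : continuous f -> continuous (fun x => - f x).
Proof. by move=> cf x; apply: cvgN; exact: cf. Qed.

Lemma continuous_funM f g : continuous f -> continuous g -> continuous (fun x => f x * g x).
Proof. by move=> cf cg x; apply: cvgM; [exact: cf|exact: cg]. Qed.

Lemma continuous_fun_cst c : continuous (fun _ : R => c).
Proof. by move=> x; exact: cvg_cst. Qed.

Lemma continuous_fun_id : continuous (fun x : R => x).
Proof. by move=> x; exact: cvg_id. Qed.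

Lemma continuous_funX f n : continuous f -> continuous (fun x => f x ^+ n).
Proof. by move=> cf x; apply: (@continuous_comp _ _ _ f (@GRing.exp R ^~ n)); [exact: cf|exact:
    exprn_continuous]. Qed.

Lemma continuous_funV f : continuous f -> (forall x, f x != 0) -> continuous (fun x => (f x)^-1).
Proof. by move=> cf f0 x; apply: cvgV => //; exact: cf. Qed.

Lemma continuous_fun_expR f : continuous f -> continuous (fun x => expR (f x)).
Proof. by move=> cf x; apply: (@continuous_comp _ _ _ f expR); [exact: cf|exact:
    continuous_expR]. Qed.

Lemma continuous_fun_norm f : continuous f -> continuous (fun x => `|f x|).
Proof. by move=> cf x; apply: cvg_norm; exact: cf. Qed.

Lemma is_derive_funD f g x (a b : R) : is_derive x (1 : R) f a -> is_derive x (1 : R) g b ->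
  is_derive x (1 : R) (fun y => f y + g y) (a + b).
Proof. exact: is_deriveD. Qed.

Lemma is_derive_funN f x (a : R) : is_derive x (1 : R) f a -> is_derive x (1 : R) (fun y => - f
    y) (- a).
Proof. exact: is_deriveN. Qed.

Lemma is_derive_funM f g x (a b : R) : is_derive x (1 : R) f a -> is_derive x (1 : R) g b ->
  is_derive x (1 : R) (fun y => f y * g y) (a * g x + f x * b).
Proof.
move=> fa gb; apply: is_derive_eq (is_deriveM fa gb) _.
by rewrite addrC mulrC.
Qed.

Lemma is_derive_fun_cst x c : is_derive x (1 : R) (fun _ : R => c) 0.
Proof. exact: is_derive_cst. Qed.

Lemma is_derive_funZ f x c (a : R) : is_derive x (1 : R) f a -> is_derive x (1 : R) (fun y => c *
    f y) (c * a).
Proof. by move=> fa; apply: is_derive_eq (is_derive_funM (is_derive_fun_cst x c) fa) _; rewrite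
    mul0r add0r. Qed.

Lemma is_derive_fun_id x : is_derive x (1 : R) (fun y : R => y) 1.
Proof. exact: is_derive_id. Qed.

Lemma is_derive_funV f x (a : R) : f x != 0 -> is_derive x (1 : R) f a ->
  is_derive x (1 : R) (fun y => (f y)^-1) (- a / f x ^+ 2).
Proof.
move=> f0 fa; apply: is_derive_eq (is_deriveV f0 fa) _.
by rewrite /GRing.scale/= mulNr mulrC mulNr.
Qed.

Lemma is_derive_fun_expR f x (a : R) : is_derive x (1 : R) f a ->
  is_derive x (1 : R) (fun y => expR (f y)) (a * expR (f x)).
Proof.
move=> fa; apply: is_derive_eq (is_derive1_comp (is_derive_expR (f x)) fa) _.
by rewrite mulrC.
Qed.

Lemma is_derive_fun_shift f x c (a : R) : is_derive (x + c) (1 : R) f a ->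
  is_derive x (1 : R) (fun y => f (y + c)) a.
Proof.
move=> fa; have h : is_derive x (1 : R) (fun y => y + c) 1.
  by apply: is_derive_eq (is_derive_funD (is_derive_fun_id x) (is_derive_fun_cst x c)) _; rewrite
      addr0.
by apply: is_derive_eq (@is_derive1_comp _ f (fun y => y + c) x a 1 fa h) _; rewrite mulr1.
Qed.

Lemma is_derive_continuous f (f' : R -> R) : (forall x, is_derive x (1 : R) f (f' x)) ->
    continuous f.
Proof.
move=> df x; apply: differentiable_continuous.
by apply/derivable1_diffP; case: (df x).
Qed.

Lemma is_derive0_constant f : (forall x, is_derive x (1 : R) f 0) -> forall x y, f x = f y.
Proof. by move=> df x y; exact: is_derive_0_is_cst. Qed.

Lemma continuous_integrable f a b : continuous f ->
  mu.-integrable `[a, b] (EFin \o f).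
Proof.
move=> cf; apply: continuous_compact_integrable; first exact: segment_compact.
exact: continuous_subspaceT.
Qed.

(** Signed integral from 0 to [x]: whatever the sign of [x], one of the two segments is empty or a
    single point, so this is an antiderivative on the whole line when [f] is continuous. *)
Definition primitive f x :=
  \int[mu]_(t in `[0, x]) f t - \int[mu]_(t in `[x, 0]) f t.

Lemma Rintegral_cat f a b c : a <= b <= c -> mu.-integrable `[a, c] (EFin \o f) ->
  \int[mu]_(t in `[a, c]) f t = \int[mu]_(t in `[a, b]) f t + \int[mu]_(t in `[b, c]) f t.
Proof.
move=> /andP[ab bc] fi; have := Rintegral_itvB fi.
move=> /(_ b); rewrite !bnd_simp => /(_ ab bc) E.
rewrite -(@Rintegral_itv_obnd_cbnd _ b (BRight c)); first by rewrite -E addrC subrK.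
apply: integrableS fi => //.
by apply: subset_itvr; rewrite bnd_simp.
Qed.

(** A base point below both 0 and [x] removes the case distinction on the sign of [x]. *)
Lemma primitive_base f a x : continuous f -> a <= 0 -> a <= x ->
  primitive f x = \int[mu]_(t in `[a, x]) f t - \int[mu]_(t in `[a, 0]) f t.
Proof.
move=> cf a0 ax; rewrite /primitive; have [x0|x0] := leP 0 x.
  rewrite [in RHS](@Rintegral_cat f a 0 x) ?a0 ?x0//; last exact: continuous_integrable.
  have -> : \int[mu]_(t in `[x, 0]) f t = 0.
    move: x0; rewrite le_eqVlt => /orP[/eqP<-|x0]; first by rewrite set_itv1 Rintegral_set1.
    by rewrite set_itv_ge ?Rintegral_set0// bnd_simp -ltNge.
  by ring.
rewrite [in RHS](@Rintegral_cat f a x 0) ?(ltW x0) ?ax//; last exact: continuous_integrable.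
have -> : \int[mu]_(t in `[0, x]) f t = 0.
  by rewrite set_itv_ge ?Rintegral_set0// bnd_simp -ltNge.
by ring.
Qed.

Lemma Rintegral_primitive f a b : continuous f -> a <= b ->
  \int[mu]_(t in `[a, b]) f t = primitive f b - primitive f a.
Proof.
move=> cf ab; pose m := Num.min a 0.
have ma : m <= a by rewrite ge_min lexx.
have m0 : m <= 0 by rewrite ge_min lexx orbT.
rewrite !(@primitive_base f m)// ?(le_trans ma)//.
rewrite (@Rintegral_cat f m a b) ?ma ?ab//; last exact: continuous_integrable.
by ring.
Qed.

Lemma primitive0 f : primitive f 0 = 0.
Proof. by rewrite /primitive subrr. Qed.

Lemma primitive_Rintegral f x : continuous f -> 0 <= x -> primitive f x = \int[mu]_(t in `[0, x])
    f t.
Proof. by move=> cf x0; rewrite Rintegral_primitive// primitive0 subr0. Qed.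

Lemma is_derive_primitive f x : continuous f -> is_derive x (1 : R) (primitive f) (f x).
Proof.
move=> cf; pose a := Num.min x 0 - 1.
have ax : a < x by rewrite /a ltrBlDr (@le_lt_trans _ _ x) ?ge_min ?lexx// ltrDl.
have a0 : a < 0 by rewrite /a ltrBlDr (@le_lt_trans _ _ 0) ?ge_min ?lexx ?orbT// ltrDl.
have xx1 : x < x + 1 by rewrite ltrDl.
have [dF F'] := @continuous_FTC1_closed _ f a x (x + 1) xx1 (continuous_integrable a (x + 1) cf)
    ax (cf x).
pose c := \int[mu]_(t in `[a, 0]) f t.
pose F := fun y => \int[mu]_(t in `[a, y]) f t.
have dFx : is_derive x (1 : R) F (f x).
  by apply: DeriveDef => //; rewrite -derive1E.
have := is_derive_funD dFx (is_derive_fun_cst x (- c)); rewrite addr0.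
apply: near_eq_is_derive => //.
near=> y; rewrite (@primitive_base f a)//; first exact: ltW.
by apply/ltW; near: y; exact: lt_nbhsr.
Unshelve. all: by end_near. Qed.

Lemma continuous_primitive f : continuous f -> continuous (primitive f).
Proof. by move=> cf; apply: (@is_derive_continuous _ f) => x; exact: is_derive_primitive. Qed.

Lemma primitive_unique f F x : continuous f -> (forall y, is_derive y (1 : R) F (f y)) ->
  primitive f x = F x - F 0.
Proof.
move=> cf dF; have D y : is_derive y (1 : R) (fun z => primitive f z - F z) 0.
  apply: is_derive_eq (is_derive_funD (is_derive_primitive _ cf) (is_derive_funN (dF y))) _.
  by rewrite subrr.
have := is_derive0_constant D x 0; rewrite primitive0; lra.
Qed.

Lemma primitiveD f g x : continuous f -> continuous g ->
  primitive (fun y => f y + g y) x = primitive f x + primitive g x.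
Proof.
move=> cf cg; have dF y := is_derive_funD (is_derive_primitive y cf) (is_derive_primitive y cg).
by rewrite (primitive_unique _ (continuous_funD cf cg) dF) !primitive0 addr0 subr0.
Qed.

Lemma primitiveZ f c x : continuous f -> primitive (fun y => c * f y) x = c * primitive f x.
Proof.
move=> cf; have dF y := is_derive_funZ c (is_derive_primitive y cf).
by rewrite (primitive_unique _ (continuous_funM (@continuous_fun_cst c) cf) dF) !primitive0 mulr0
    subr0.
Qed.

Lemma primitiveN f x : continuous f -> primitive (fun y => - f y) x = - primitive f x.
Proof.
move=> cf; rewrite (_ : (fun y => - f y) = (fun y => -1 * f y)); last first.
  by apply/funext => y; rewrite mulN1r.
by rewrite primitiveZ// mulN1r.
Qed.

Lemma primitiveB f g x : continuous f -> continuous g ->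
  primitive (fun y => f y - g y) x = primitive f x - primitive g x.
Proof. by move=> cf cg; rewrite primitiveD ?primitiveN//; exact: continuous_funN. Qed.

Lemma primitive_cst c x : primitive (fun _ => c) x = c * x.
Proof.
have dF y : is_derive y (1 : R) (fun z => c * z) c.
  by apply: is_derive_eq (is_derive_funZ c (is_derive_fun_id y)) _; rewrite mulr1.
by rewrite (primitive_unique _ (@continuous_fun_cst c) dF) mulr0 subr0.
Qed.

Lemma le_primitiveB f g a b : continuous f -> continuous g -> a <= b ->
  (forall x, a <= x <= b -> f x <= g x) ->
  primitive f b - primitive f a <= primitive g b - primitive g a.
Proof.
move=> cf cg ab fg; rewrite -!Rintegral_primitive//.
by apply: le_Rintegral => //; exact: continuous_integrable.
Qed.

Lemma le_primitive f g x : continuous f -> continuous g -> 0 <= x ->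
  (forall y, 0 <= y <= x -> f y <= g y) -> primitive f x <= primitive g x.
Proof. by move=> cf cg x0 fg; have := le_primitiveB cf cg x0 fg; rewrite !primitive0 !subr0. Qed.

Lemma primitive_ge0 f x : continuous f -> 0 <= x -> (forall y, 0 <= f y) -> 0 <= primitive f x.
Proof.
move=> cf x0 f0; have := @le_primitive (fun _ => 0) f x (@continuous_fun_cst 0) cf x0.
by rewrite primitive_cst mul0r; apply => y _; exact: f0.
Qed.

Lemma primitive_periodic f L x : continuous f -> periodic f L ->
  primitive f (x + L) = primitive f x + primitive f L.
Proof.
move=> cf pf; have D y : is_derive y (1 : R) (fun z => primitive f (z + L) - primitive f z) 0.
  apply: is_derive_eq (is_derive_funD (is_derive_fun_shift (is_derive_primitive _ cf))
      (is_derive_funN (is_derive_primitive _ cf))) _.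
  by rewrite pf subrr.
have := is_derive0_constant D x 0; rewrite primitive0 add0r; lra.
Qed.

Lemma primitive_derivative F f L : continuous f -> (forall y, is_derive y (1 : R) F (f y)) ->
  periodic F L -> primitive f L = 0.
Proof. by move=> cf dF pF; rewrite (primitive_unique _ cf dF) -[L in F L]add0r pF subrr. Qed.

End calculus.

Ltac continuity_rec := lazymatch goal with
  | |- continuous_alias (fun _ => ?c) => exact: (@continuous_fun_cst _ c)
  | |- continuous_alias (fun x => x) => exact: continuous_fun_id
  | |- continuous_alias (fun x => @Algebra.add _ (@?f x) (@?g x)) =>
      refine (@continuous_funD _ f g _ _); apply: continuous_alias_elim; continuity_rec
  | |- continuous_alias (fun x => @Algebra.opp _ (@?f x)) =>
      refine (@continuous_funN _ f _); apply: continuous_alias_elim; continuity_rec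
  | |- continuous_alias (fun x => @GRing.mul _ (@?f x) (@?g x)) =>
      refine (@continuous_funM _ f g _ _); apply: continuous_alias_elim; continuity_rec
  | |- continuous_alias (fun x => @GRing.exp _ (@?f x) ?n) =>
      refine (@continuous_funX _ f n _); apply: continuous_alias_elim; continuity_rec
  | |- continuous_alias (fun x => @Num.norm _ _ (@?f x)) =>
      refine (@continuous_fun_norm _ f _); apply: continuous_alias_elim; continuity_rec
  | |- continuous_alias (fun x => @expR _ (@?f x)) =>
      refine (@continuous_fun_expR _ f _); apply: continuous_alias_elim; continuity_rec
  | |- _ => try assumption
  end.

Ltac continuity := apply: continuous_alias_elim; continuity_rec.

(** * Periodic solutions of first-order linear equations *)

Section periodic_solution.
Context {R : realType}.
Implicit Types (f g h V : R -> R) (x y : R).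

(** Variation of constants for [S' = V S - h]. When [V] has nonzero mean, the constant is the only
    one that makes [S] periodic for periodic [V] and [h]. *)
Definition periodic_solution (L : R) V h x :=
  let E := primitive V in let H := primitive (fun y => expR (- E y) * h y) in
  expR (E x) * (H L / (1 - expR (- E L)) - H x).

Variables (L : R) (L0 : 0 < L).

Section fixed_coefficient.
Variables (V : R -> R) (cV : continuous V) (pV : periodic V L).
Let E := primitive V.
Let S := periodic_solution L V.
Hypothesis EL0 : E L != 0.

Let cE : continuous E. Proof. exact: continuous_primitive. Qed.

Let cH h : continuous h -> continuous (fun y => expR (- E y) * h y).
Proof. by move=> ch; apply: continuous_funM => //; apply: continuous_fun_expR; exact:
    continuous_funN. Qed.

Let den0 : 1 - expR (- E L) != 0.
Proof.
apply: contra EL0; rewrite subr_eq0 eq_sym -expR0 => /eqP /expR_inj /eqP.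
by rewrite oppr_eq0.
Qed.

Lemma periodic_solution_derive h x : continuous h ->
  is_derive x (1 : R) (S h) (V x * S h x - h x).
Proof.
move=> ch; have dE := is_derive_primitive x cV.
have dH := is_derive_primitive x (cH ch).
have := is_derive_funM (is_derive_fun_expR dE) (is_derive_funD (is_derive_fun_cst x (primitive
    (fun y => expR (- E y) * h y) L / (1 - expR (- E L)))) (is_derive_funN dH)).
move=> H; apply: is_derive_eq H _.
rewrite /S /periodic_solution -/E (expRN (E x)).
have ? : expR (E x) != 0 by rewrite gt_eqF// expR_gt0.
by field; rewrite den0; apply/andP.
Qed.

Lemma continuous_periodic_solution h : continuous h -> continuous (S h).
Proof. by move=> ch; apply: is_derive_continuous => x; exact: periodic_solution_derive. Qed.

(** Translation by a period multiplies the weight [expR (- E y)] by [expR (- E L)], so both sides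
    have the same derivative. *)
Let shiftH h y : continuous h -> periodic h L ->
  primitive (fun y => expR (- E y) * h y) (y + L) =
  expR (- E L) * primitive (fun y => expR (- E y) * h y) y + primitive (fun y => expR (- E y) * h
      y) L.
Proof.
move=> ch ph; set H := primitive _.
have D z : is_derive z (1 : R) (fun z => H (z + L) - expR (- E L) * H z) 0.
  apply: is_derive_eq (is_derive_funD (is_derive_fun_shift (is_derive_primitive _ (cH ch)))
    (is_derive_funN (is_derive_funZ _ (is_derive_primitive _ (cH ch))))) _.
  have e1 : expR (- E (z + L)) = expR (- E L) * expR (- E z).
    by rewrite -expRD -opprD; congr (expR (- _)); rewrite [RHS]addrC; exact: primitive_periodic.
  by rewrite ph e1 -mulrA subrr.
have := is_derive0_constant D y 0; rewrite add0r (primitive0 _ : H 0 = 0) mulr0 subr0.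
by move/eqP; rewrite subr_eq => /eqP ->; rewrite addrC.
Qed.

Lemma periodic_solution_periodic h : continuous h -> periodic h L -> periodic (S h) L.
Proof.
move=> ch ph x; rewrite /S /periodic_solution -/E shiftH// {1}/E primitive_periodic// -/E.
rewrite expRD; set H := primitive _.
have EE : expR (E L) * expR (- E L) = 1 by rewrite -expRD subrr expR0.
have d := den0; set a := expR (- E L) in d EE *.
have e0 : expR (E L) != 0 by rewrite gt_eqF// expR_gt0.
have {}EE : expR (E L) = a^-1.
  by apply: (mulIf (x := a)); rewrite ?EE ?mulVf// gt_eqF// expR_gt0.
have a0 : a != 0 by rewrite gt_eqF// expR_gt0.
by rewrite EE; field; rewrite a0 d.
Qed.

Let N := primitive (fun y => `|V y|) L.

Let cnV : continuous (fun y => `|V y|). Proof. exact: continuous_fun_norm. Qed.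

Let E_dist x y : x <= y <= x + L -> `|E y - E x| <= N.
Proof.
move=> /andP[xy yx].
have H1 := le_primitiveB cV cnV xy (fun z _ => ler_norm _).
have H2 : - (E y - E x) <= primitive (fun y => `|V y|) y - primitive (fun y => `|V y|) x.
  have VN z : x <= z <= y -> - V z <= `|V z| by rewrite -normrN => _; exact: ler_norm.
  have := le_primitiveB (continuous_funN cV) cnV xy VN.
  by rewrite !primitiveN// /E; lra.
have H3 : primitive (fun y => `|V y|) y - primitive (fun y => `|V y|) x <= N.
  have pn : periodic (fun y => `|V y|) L by move=> z; rewrite pV.
  rewrite lerBlDr addrC /N -primitive_periodic//.
  have := @le_primitiveB _ (fun=> 0) _ y (x + L) (@continuous_fun_cst _ 0) cnV yx (fun z _ =>
      normr_ge0 _).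
  rewrite !primitive_cst !mul0r subrr; lra.
by rewrite ler_norml -lerNl (le_trans H2)//= (le_trans H1).
Qed.

(** Multiplication by [1 - expR (- E L)] turns [S h x] into the integral of [expR (E x - E y) * h y]
    over [[x, x + L]], and this kernel lies between [expR (- N)] and [expR N]. The factor is not
    divided out because its sign is that of the mean of [V]. *)
Lemma periodic_solution_bounds h x : continuous h -> periodic h L -> (forall y, 0 <= h y) ->
  expR (- N) * primitive h L <= (1 - expR (- E L)) * S h x <= expR N * primitive h L.
Proof.
move=> ch ph h0; set H := primitive (fun y => expR (- E y) * h y).
have xL : x <= x + L by rewrite lerDl ltW.
have -> : (1 - expR (- E L)) * S h x = expR (E x) * (H (x + L) - H x).
  rewrite /S /periodic_solution -/E -/H /H shiftH// -/H mulrCA; congr (_ * _).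
  by rewrite mulrBr mulrCA divff// mulr1; ring.
have hE c : c * primitive h L = c * primitive h (x + L) - c * primitive h x.
  by rewrite primitive_periodic//; ring.
rewrite !hE -!primitiveZ//.
have cc c : continuous (fun y => c * h y) by apply: continuous_funM => //; exact:
    continuous_fun_cst.
have -> : expR (E x) * (H (x + L) - H x) =
  primitive (fun y => expR (E x) * (expR (- E y) * h y)) (x + L) -
  primitive (fun y => expR (E x) * (expR (- E y) * h y)) x.
  by rewrite !primitiveZ ?mulrBr//; exact: cH.
have cx : continuous (fun y => expR (E x) * (expR (- E y) * h y)).
  by apply: continuous_funM; [exact: continuous_fun_cst|exact: cH].
apply/andP; split; apply: le_primitiveB => // y xy;
  have := E_dist xy; rewrite ler_norml => /andP[E1 E2];
  rewrite mulrA -expRD ler_wpM2r// ler_expR; lra.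
Qed.

Lemma periodic_solutionD f g x : continuous f -> continuous g ->
  S (fun y => f y + g y) x = S f x + S g x.
Proof.
move=> cf cg; rewrite /S /periodic_solution -/E.
under eq_fun do rewrite mulrDr.
by rewrite !primitiveD; [field|exact: cH..].
Qed.

Lemma periodic_solutionZ c f x : continuous f -> S (fun y => c * f y) x = c * S f x.
Proof.
move=> cf; rewrite /S /periodic_solution -/E.
under eq_fun do rewrite mulrCA.
by rewrite !primitiveZ; [field|exact: cH..].
Qed.

End fixed_coefficient.
End periodic_solution.

(** * Absolutely continuous functions *)

Section absolutely_continuous.
Context {R : realType}.
Implicit Types (f g F G : R -> R) (a b x y : R).

Local Notation mu := (@lebesgue_measure R).

Lemma continuous_segment_bounded g a b : continuous g ->
  exists2 M, 0 <= M & forall x, a <= x <= b -> `|g x| <= M.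
Proof.
move=> cg; have [ab|ba] := leP a b; last first.
  exists 0 => // x /andP[ax xb]; have := lt_le_trans ba (le_trans ax xb).
  by rewrite ltxx.
have cn : {within `[a, b], continuous (fun x => `|g x|)}.
  by apply: continuous_subspaceT; exact: continuous_fun_norm.
have [c _ gc] := EVT_max ab cn.
by exists `|g c| => // x xab; apply: gc; rewrite in_itv.
Qed.

Lemma locally_integrable_itv f a b : locally_integrable setT f ->
  mu.-integrable `[a, b] (EFin \o f).
Proof.
move=> [mf _ fi]; apply/integrableP; split.
  apply/measurable_EFinP.
  exact: (@measurable_funS _ _ _ _ setT).
apply: fi => //; exact: segment_compact.
Qed.

Lemma continuous_measurable f (D : set R) : continuous f -> measurable D -> measurable_fun D f.
Proof.
move=> cf mD; apply: (@measurable_funS _ _ _ _ setT) => //.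
exact: continuous_measurable_fun.
Qed.

Lemma integrable_mul_continuous f g a b : mu.-integrable `[a, b] (EFin \o f) -> continuous g ->
  mu.-integrable `[a, b] (EFin \o (fun x => f x * g x)).
Proof.
move=> fi cg; have mg := continuous_measurable cg (measurable_itv `[a, b]).
have [M M0 gM] := continuous_segment_bounded a b cg.
have bg : [bounded g x | x in `[a, b]%classic].
  exists M; split; first exact: num_real.
  move=> y My x /=; rewrite in_itv/= => xab.
  by apply: le_trans (gM _ xab) _; exact: ltW.
by have := integrableMl _ fi mg bg; apply.
Qed.

Lemma Rintegral_ae f g (D : set R) : measurable D -> measurable_fun D f -> measurable_fun D g ->
  {ae mu, forall x, D x -> f x = g x} ->
  \int[mu]_(x in D) f x = \int[mu]_(x in D) g x.
Proof.
move=> mD mf mg fg; rewrite /Rintegral; congr fine.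
apply: ae_eq_integral => //; try exact/measurable_EFinP.
apply: filterS fg; first exact: (ae_filter_ringOfSetsType mu).
by move=> x /= fg Dx; rewrite fg.
Qed.

Lemma L1loc_derivative_continuous F f : is_L1loc_derivative F f -> continuous F.
Proof.
move=> [lf dF] x; pose a := x - 1.
have ab : a < x + 1 by rewrite /a; lra.
have cI := @parameterized_integral_continuous _ a (x + 1) f (ltW ab) (locally_integrable_itv a (x
    + 1) lf).
have xab : x \in `]a, x + 1[ by rewrite in_itv/= /a; apply/andP; split; lra.
have {}cI := within_continuous_continuous ab cI xab.
have : (fun y => F a + parameterized_integral mu a y f) y @[y --> x] -->
       F a + parameterized_integral mu a x f.
  by apply: cvgD; [exact: cvg_cst|exact: cI].
have E y : a <= y -> F a + parameterized_integral mu a y f = F y.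
  by move=> ay; rewrite /parameterized_integral -dF//; ring.
rewrite E; last by rewrite /a; lra.
apply: cvg_trans; apply: near_eq_cvg; near=> y.
rewrite E//; apply/ltW; near: y; apply: lt_nbhsr; rewrite /a; lra.
Unshelve. all: by end_near. Qed.

(* An increment bound superadditive in the length forces constancy: subdivide. *)
Lemma constant_of_superlinear_increments (G A : R -> R) K L : 0 <= L ->
  (forall x y, 0 <= x <= y -> y <= L -> `|G y - G x| <= K * (y - x) * (A y - A x)) ->
  G L = G 0.
Proof.
move=> L0 GA; pose e (n : nat) := L / n.+1%:R.
have e0 n : 0 <= e n by rewrite divr_ge0.
have step n k : (k <= n.+1)%N ->
    `|G (e n *+ k) - G 0| <= K * e n * (A (e n *+ k) - A 0).
  elim: k => [|k IH] kn; first by rewrite mulr0n !subrr mulr0 normr0.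
  have {}IH := IH (ltnW kn).
  have kL : e n *+ k.+1 <= L.
    have -> : L = e n *+ n.+1 by rewrite /e -mulr_natr divfK.
    by rewrite -[leLHS]mulr_natr -[leRHS]mulr_natr ler_wpM2l// ler_nat.
  have := GA (e n *+ k) (e n *+ k.+1).
  rewrite mulrn_wge0//= !mulrS lerDr e0 => /(_ isT).
  rewrite -mulrS => /(_ kL); rewrite mulrS addrK => H.
  have -> : G (e n + e n *+ k) - G 0 = (G (e n + e n *+ k) - G (e n *+ k)) + (G (e n *+ k) - G 0).
    by ring.
  apply: le_trans (ler_normD _ _) _; apply: le_trans (lerD H IH) _.
  by rewrite -mulrDr le_eqVlt; apply/orP; left; apply/eqP; congr (_ * _); ring.
apply/eqP; rewrite -subr_eq0 -normr_eq0; apply/eqP/le_anti; rewrite normr_ge0 andbT.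
apply/ler_addgt0Pl => eps eps0; rewrite addr0.
pose C := `|K * (A L - A 0)|.
pose n := Num.truncn (C * L / eps).
have CL : C * e n <= eps.
  rewrite /e mulrA ler_pdivrMr// -ler_pdivrMl// mulrC; apply/ltW.
  exact: truncnS_gt.
apply: le_trans CL; have := step n n.+1 (leqnn _).
have -> : e n *+ n.+1 = L by rewrite /e -mulr_natr divfK.
move=> /le_trans; apply; rewrite mulrAC; apply: ler_wpM2r => //.
exact: ler_norm.
Qed.

(** The increment over [[x, y]] of the defect [G] is the integral of [f (g - g y) + (F - F x) g'].
    It is at most [2 M (y - x)] times the integral of [|f|], so subdivision shows that [G] is
    constant. *)
Lemma L1loc_integration_by_parts F f g (g' : R -> R) L : 0 <= L -> is_L1loc_derivative F f ->
  (forall x, is_derive x (1 : R) g (g' x)) -> continuous g' ->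
  \int[mu]_(t in `[0, L]) (f t * g t) =
  F L * g L - F 0 * g 0 - \int[mu]_(t in `[0, L]) (F t * g' t).
Proof.
move=> L0 dF dg cg'; have cF := L1loc_derivative_continuous dF.
have [lf dF'] := dF.
have cg : continuous g by exact: is_derive_continuous dg.
have [M M0 gM] := continuous_segment_bounded 0 L cg'.
have fi a b := locally_integrable_itv a b lf.
have fgi a b := integrable_mul_continuous (fi a b) cg.
have Fgi a b := continuous_integrable a b (continuous_funM cF cg').
pose G x := \int[mu]_(t in `[0, x]) (f t * g t) + \int[mu]_(t in `[0, x]) (F t * g' t) - F x * g x.
pose A x := \int[mu]_(t in `[0, x]) `|f t|.
have nfi a b : mu.-integrable `[a, b] (EFin \o (fun x => `|f x|)) by exact: integrable_norm.
suff : G L = G 0 by rewrite /G !set_itv1 !Rintegral_set1; lra.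
apply: (@constant_of_superlinear_increments G A (2 * M)) => // x y /andP[x0 xy] yL.
have -> : A y - A x = \int[mu]_(t in `[x, y]) `|f t|.
  by rewrite /A (@Rintegral_cat _ _ 0 x y) ?x0//; ring.
have -> : G y - G x = \int[mu]_(t in `[x, y]) (f t * (g t - g y) + (F t - F x) * g' t).
  rewrite /G (@Rintegral_cat _ _ 0 x y) ?x0// [X in _ + X - F y * _](@Rintegral_cat _ _ 0 x y)
      ?x0//.
  under [RHS]eq_Rintegral => t _.
    rewrite (_ : _ + _ = f t * g t + F t * g' t - (g y * f t + F x * g' t)); last by ring.
    over.
  have i1 : mu.-integrable `[x, y] (EFin \o (fun t => f t * g t + F t * g' t)).
    exact: (integrableD _ (fgi _ _) (Fgi _ _)).
  have i2 : mu.-integrable `[x, y] (EFin \o (fun t => g y * f t)) by exact: (integrableZl _ (g y)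
      (fi _ _)).
  have i3 : mu.-integrable `[x, y] (EFin \o (fun t => F x * g' t)) by exact: (integrableZl _ (F
      x) (continuous_integrable _ _ cg')).
  have i4 : mu.-integrable `[x, y] (EFin \o (fun t => g y * f t + F x * g' t)) by exact:
      (integrableD _ i2 i3).
  rewrite RintegralB// RintegralD// RintegralD// !RintegralZl//; last exact: continuous_integrable.
  have -> : \int[mu]_(t in `[x, y]) g' t = g y - g x.
    by rewrite Rintegral_primitive// !(primitive_unique _ cg' dg); ring.
  by rewrite -dF'//; ring.
have ci1 : mu.-integrable `[x, y] (EFin \o (fun t => f t * (g t - g y))).
  by apply: integrable_mul_continuous => //; apply: continuous_funD => //; exact:
      continuous_fun_cst.
have ci2 : mu.-integrable `[x, y] (EFin \o (fun t => (F t - F x) * g' t)).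
  by apply: continuous_integrable; apply: continuous_funM => //; apply: continuous_funD => //;
      exact: continuous_fun_cst.
have ci : mu.-integrable `[x, y] (EFin \o (fun t => f t * (g t - g y) + (F t - F x) * g' t)).
  exact: (integrableD _ ci1 ci2).
apply: le_trans (le_normr_Rintegral _ ci) _ => //.
pose I := \int[mu]_(t in `[x, y]) `|f t|.
have xyL t : x <= t <= y -> 0 <= t <= L.
  by move=> /andP[xt ty]; rewrite (le_trans x0 xt) (le_trans ty yL).
have ig t : x <= t <= y -> `|g t - g y| <= M * (y - x).
  move=> /andP[xt ty]; have : `|\int[mu]_(s in `[t, y]) g' s| <= M * (y - t).
    apply: le_trans (le_normr_Rintegral _ (continuous_integrable _ _ cg')) _ => //.
    apply: (@le_trans _ _ (\int[mu]_(s in `[t, y]) M)).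
      apply: le_Rintegral => //.
      - by apply: continuous_integrable; exact: continuous_fun_norm.
      - by apply: continuous_integrable; exact: continuous_fun_cst.
      move=> s /=; rewrite in_itv/= => /andP[ts sy]; apply: gM.
      by apply: xyL; rewrite (le_trans xt ts).
    by rewrite Rintegral_primitive//; [rewrite !primitive_cst mulrBr|exact: continuous_fun_cst].
  rewrite Rintegral_primitive// !(primitive_unique _ cg' dg).
  have -> : g y - g 0 - (g t - g 0) = g y - g t by ring.
  by rewrite distrC => /le_trans; apply; rewrite ler_wpM2l// lerB.
have iF t : x <= t <= y -> `|F t - F x| <= I.
  move=> /andP[xt ty]; rewrite dF'//; apply: le_trans (le_normr_Rintegral _ (fi _ _)) _ => //.
  rewrite /I (@Rintegral_cat _ _ x t y) ?xt//; rewrite lerDl.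
  by apply: Rintegral_ge0 => s _.
have I0 : 0 <= I by apply: Rintegral_ge0.
have j1 : mu.-integrable `[x, y] (EFin \o (fun t => M * (y - x) * `|f t|)).
  exact: (integrableZl _ _ (nfi _ _)).
have j2 : mu.-integrable `[x, y] (EFin \o (fun _ : R => I * M)).
  by apply: continuous_integrable; exact: continuous_fun_cst.
apply: (@le_trans _ _ (\int[mu]_(t in `[x, y]) (M * (y - x) * `|f t| + I * M))).
  apply: le_Rintegral => //.
  - by have /integrable_norm := ci.
  - exact: (integrableD _ j1 j2).
  move=> t /=; rewrite in_itv/= => xty; apply: le_trans (ler_normD _ _) _.
  rewrite !normrM mulrC; apply: lerD.
    by apply: ler_wpM2r => //; exact: ig.
  by apply: ler_pM => //; [exact: iF|exact/gM/xyL].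
have -> : \int[mu]_(t in `[x, y]) (M * (y - x) * `|f t| + I * M) = 2 * M * (y - x) * I.
  rewrite RintegralD// RintegralZl// -/I.
  rewrite (Rintegral_primitive (@continuous_fun_cst _ (I * M)) xy) !primitive_cst; ring.
by [].
Qed.

End absolutely_continuous.

(** * The Riccati equation in weak form *)

Section weak_riccati.
Context {R : realType}.
Implicit Types (f g b v : R -> R) (x y L lambda k m : R).

Local Notation mu := (@lebesgue_measure R).

Lemma periodic_mulrz f L x (n : int) : periodic f L -> f (x + L *~ n) = f x.
Proof.
move=> pf; case: n => n; first by rewrite -pmulrn; exact: periodicn.
by rewrite NegzE mulrNz -pmulrn -[in RHS](subrK (L *+ n.+1) x); rewrite (periodicn pf).
Qed.

Lemma periodic_segment L x : 0 < L ->
  exists2 y, 0 <= y <= L & forall f, periodic f L -> f x = f y.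
Proof.
move=> L0; pose n := Num.floor (x / L).
exists (x + L *~ (- n)); last by move=> f pf; rewrite periodic_mulrz.
have /andP[nx xn] := floor_itv (x / L).
rewrite mulrNz -mulrzr; move: nx xn; rewrite -/n ler_pdivlMr// ltr_pdivrMr// intrD; lra.
Qed.

Lemma periodic_derive1 f L : periodic f L -> (forall x, derivable f x 1) -> periodic (derive1 f) L.
Proof.
move=> pf df x.
have H : is_derive (x + L) (1 : R) f (derive1 f (x + L)) by rewrite derive1E; exact: derivableP.
have := is_derive_fun_shift H; rewrite (_ : (fun y => f (y + L)) = f); last exact/funext.
by move=> h; rewrite [RHS]derive1E; apply/esym/derive_val.
Qed.

(** Weak form of [v' = m - b - v ^+ 2] with [v] of mean [lambda]: the derivative is moved onto a
    periodic C^1 test function, because [b] is merely locally integrable and [v'] may fail to exist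
    at some points. *)
Definition weak_riccati L b m lambda v :=
  [/\ continuous v, periodic v L, primitive v L = lambda * L &
  forall g (g' : R -> R), (forall x, is_derive x (1 : R) g (g' x)) -> continuous g' ->
    periodic g L ->
    \int[mu]_(x in `[0, L]) (b x * g x) =
    primitive (fun x => m * g x + v x * g' x - v x ^+ 2 * g x) L].

(** [v] is the logarithmic derivative of the eigenfunction plus [lambda]; the eigenvalue equation is
    tested with [g / psi]. The second conclusion is a regularity statement: the equation expresses
    [b] through [psi], so agreement with a continuous periodic [B] on one period propagates to the
    line by periodicity of [psi]. *)
Lemma principal_eigenvalue_riccati L lambda b k : 0 < L -> locally_integrable setT b ->
  is_principal_eigenvalue L lambda b k ->
  exists2 v, weak_riccati L b (- k) lambda v &
  forall B, continuous B -> periodic B L -> {ae mu, forall x, 0 <= x <= L -> b x = B x} ->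
    (forall x, is_derive x (1 : R) v (- k - B x - v x ^+ 2)) /\ {ae mu, forall x, B x = b x}.
Proof.
move=> L0 lb [psi [psi'' [ppsi psi0 dpsi dpsi' eqn]]].
have afil := ae_filter_ringOfSetsType mu.
pose psi' := derive1 psi.
have ipsi x : is_derive x (1 : R) psi (psi' x).
  by rewrite /psi' derive1E; exact: derivableP.
have cpsi : continuous psi := is_derive_continuous ipsi.
have cpsi' : continuous psi' := L1loc_derivative_continuous dpsi'.
have ppsi' : periodic psi' L := periodic_derive1 ppsi dpsi.
have psin0 x : psi x != 0 by rewrite gt_eqF.
pose u x := psi' x / psi x.
have cu : continuous u by apply: continuous_funM => //; exact: continuous_funV.
have pu : periodic u L by move=> x; rewrite /u ppsi ppsi'.
pose v x := u x + lambda.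
have cv : continuous v by apply: continuous_funD => //; exact: continuous_fun_cst.
have intu : primitive u L = 0.
  apply: (@primitive_derivative _ (fun x => ln (psi x))) => //.
    move=> x; apply: is_derive_eq (is_derive1_comp (is_derive1_ln (psi0 x)) (ipsi x)) _.
    by rewrite mulrC.
  by move=> x; rewrite ppsi.
have [lpsi'' _] := dpsi'.
have meas D : measurable D -> measurable_fun D psi''.
  by case: lpsi'' => mf _ _ mD; exact: (@measurable_funS _ _ _ _ setT).
have measb D : measurable D -> measurable_fun D b.
  by case: lb => mf _ _ mD; exact: (@measurable_funS _ _ _ _ setT).
exists v.
  split => //.
  - by move=> x; rewrite /v pu.
  - by rewrite /v primitiveD ?primitive_cst ?intu ?add0r//; exact: continuous_fun_cst.
  move=> g g' dg cg' pg; have cg : continuous g := is_derive_continuous dg.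
  pose G x := g x * (psi x)^-1.
  pose G' x := g' x * (psi x)^-1 + g x * (- psi' x / psi x ^+ 2).
  have dG x : is_derive x (1 : R) G (G' x) by apply: is_derive_funM => //; exact: is_derive_funV.
  have cV : continuous (fun x => (psi x)^-1) by exact: continuous_funV.
  have cG : continuous G by exact: continuous_funM.
  have cG' : continuous G'.
    apply: continuous_funD; first exact: continuous_funM.
    apply: continuous_funM => //; apply: continuous_funM; first exact: continuous_funN.
    by apply: continuous_funV => [|x]; [exact: continuous_funX|rewrite expf_neq0].
  have ibp := L1loc_integration_by_parts (ltW L0) dpsi' dG cG'.
  have GL : G L = G 0 by rewrite /G -[L]add0r ppsi pg.
  move: ibp; rewrite GL -[in _ * G 0 - _](add0r L) -/psi' ppsi' subrr sub0r => ibp.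
  pose h x := (2 * lambda * psi' x + (lambda ^+ 2 + k) * psi x) * G x.
  have ch : continuous h.
    by apply: continuous_funM => //; apply: continuous_funD; apply: continuous_funM => //; exact:
        continuous_fun_cst.
  have i1 : mu.-integrable `[0, L] (EFin \o (fun x => psi'' x * G x)).
    by apply: integrable_mul_continuous => //; exact: locally_integrable_itv.
  have i2 : mu.-integrable `[0, L] (EFin \o h) by exact: continuous_integrable.
  have -> : \int[mu]_(x in `[0, L]) (b x * g x) =
      \int[mu]_(x in `[0, L]) (- 1 * (psi'' x * G x + h x)).
    apply: Rintegral_ae => //.
    - by apply: measurable_funM; [exact: measb|exact: continuous_measurable].
    - apply: measurable_funM; first exact: measurable_cst.
      apply: measurable_funD; last exact: continuous_measurable.
      by apply: measurable_funM; [exact: meas|exact: continuous_measurable].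
    apply: filterS eqn => x E _; rewrite /h /G.
    have -> : b x = - (psi'' x + 2 * lambda * psi' x + (lambda ^+ 2 + k) * psi x) / psi x.
      apply: (mulIf (psin0 x)); rewrite divfK//; rewrite -/psi' in E; lra.
    by field.
  rewrite RintegralZl//; last exact: (integrableD _ i1 i2).
  rewrite RintegralD// ibp !Rintegral_primitive ?(ltW L0)//; last exact: continuous_funM.
  rewrite !primitive0 !subr0.
  have cpG : continuous (fun x => psi' x * G' x) by exact: continuous_funM.
  have intg' : primitive g' L = 0 by exact: (primitive_derivative cg' dg pg).
  have -> : -1 * (- primitive (fun x => psi' x * G' x) L + primitive h L) =
    primitive (fun x => psi' x * G' x - h x + lambda * g' x) L.
    rewrite primitiveD ?primitiveB ?primitiveZ// ?intg'; first by ring.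
      by apply: continuous_funD => //; exact: continuous_funN.
    by apply: continuous_funM => //; exact: continuous_fun_cst.
  congr (primitive _ L); apply/funext => x; rewrite /h /G /G' /v /u; field.
  exact: psin0.
move=> B cB pB bB.
(* The value of [psi''] that the equation prescribes once [b] is replaced by [B]. *)
pose f x := - (2 * lambda * psi' x + (B x + lambda ^+ 2 + k) * psi x).
have cf : continuous f.
  apply: continuous_funN; apply: continuous_funD; apply: continuous_funM => //; first exact:
      continuous_fun_cst.
  by apply: continuous_funD; [apply: continuous_funD => //|]; exact: continuous_fun_cst.
have pf : periodic f L by move=> x; rewrite /f ppsi ppsi' pB.
have psif : {ae mu, forall x, 0 <= x <= L -> psi'' x = f x}.
  apply: filterS2 eqn bB => x E bB xL; move: E; rewrite bB// -/psi' /f; lra.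
have loc y : 0 <= y <= L -> psi' y - psi' 0 = primitive f y.
  move=> /andP[y0 yL]; rewrite primitive_Rintegral// /psi' dpsi'.2//.
  apply: Rintegral_ae => //; [exact: meas|exact: continuous_measurable|].
  apply: filterS psif => x E xy; apply: E; move: xy; rewrite /= in_itv/=.
  by move=> /andP[-> /le_trans]; apply.
have fL : primitive f L = 0.
  by rewrite -loc ?lexx ?ltW// -[in psi' L](add0r L) ppsi' subrr.
(* On one period [G] is constant; being periodic, it is constant everywhere, which makes [psi'] of
   class C^1. *)
pose G x := psi' x - primitive f x.
have pG : periodic G L by move=> x; rewrite /G ppsi' primitive_periodic// fL addr0.
have psi'E x : psi' x = psi' 0 + primitive f x.
  have [y yL GE] := periodic_segment x L0.
  by have := GE G pG; rewrite {2}/G -loc// /G; lra.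
have dpsi'f x : is_derive x (1 : R) psi' (f x).
  rewrite (_ : psi' = fun y => psi' 0 + primitive f y); last exact/funext.
  by apply: is_derive_eq (is_derive_funD (is_derive_fun_cst x (psi' 0)) (is_derive_primitive x
      cf)) _; rewrite add0r.
split.
  move=> x; apply: is_derive_eq (is_derive_funD (is_derive_funM (dpsi'f x) (is_derive_funV (psin0
      x) (ipsi x))) (is_derive_fun_cst x lambda)) _.
  by rewrite /f /v /u; field; exact: psin0.
(* Lebesgue differentiation on the half-lines starting at [- n], compared with the classical
   derivative of [psi']; the countable union of the exceptional sets is null. *)
have aepsi n : {ae mu, forall x, - n%:R < x -> psi'' x = f x}.
  have := @FTC1 _ psi'' (BLeft (- n%:R)) (fun y => locally_integrable_itv _ y lpsi'') lpsi''.
  apply: filterS => x H xn; have [|_ <-] := H; first by rewrite lte_fin.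
  rewrite derive1E; apply: derive_val.
  have := is_derive_funD (dpsi'f x) (is_derive_fun_cst x (- psi' (- n%:R))); rewrite addr0.
  apply: near_eq_is_derive => //; near=> y; rewrite -dpsi'.2//.
  by apply/ltW; near: y; exact: lt_nbhsr.
have := ae_foralln aepsi.
apply: filterS2 eqn => x E H.
have [n xn] : exists n : nat, - n%:R < x.
  exists (Num.truncn (- x)).+1; rewrite ltrNl; exact: truncnS_gt.
have := H n xn; move: E; rewrite -/psi' /f => E1 E2.
apply: (mulIf (psin0 x)); move: E1; rewrite E2; lra.
Unshelve. all: by end_near. Qed.

End weak_riccati.

(** * Comparison of solutions of the Riccati equation *)

Section riccati_comparison.
Context {R : realType}.
Implicit Types (f g b v : R -> R) (x y lambda k m : R).

Local Notation mu := (@lebesgue_measure R).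

Variables (L : R) (L0 : 0 < L).

Let L_ge0 : 0 <= L. Proof. exact: ltW. Qed.

Let periodic_cst (c : R) : periodic (fun _ : R => c) L. Proof. by []. Qed.

Definition riccati_weight v := periodic_solution L (fun x => 2 * v x) (fun=> 1).

Section weight.
Variables (v : R -> R) (lambda : R).
Hypotheses (cv : continuous v) (pv : periodic v L) (vl : primitive v L = lambda * L)
  (l0 : 0 < lambda).
Let p := riccati_weight v.

Let c2v : continuous (fun x => 2 * v x). Proof. by continuity. Qed.

Let int2v : primitive (fun x => 2 * v x) L = 2 * lambda * L.
Proof. by rewrite primitiveZ// vl; ring. Qed.

Let int2v0 : primitive (fun x => 2 * v x) L != 0.
Proof. by rewrite int2v gt_eqF// !mulr_gt0. Qed.

Let p2v : periodic (fun x => 2 * v x) L.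
Proof. by move=> x; rewrite pv. Qed.

Lemma riccati_weight_derive x : is_derive x (1 : R) p (2 * v x * p x - 1).
Proof. exact: (periodic_solution_derive c2v int2v0 x (@continuous_fun_cst _ 1)). Qed.

Lemma riccati_weight_continuous : continuous p.
Proof. exact: is_derive_continuous riccati_weight_derive. Qed.

Lemma riccati_weight_periodic : periodic p L.
Proof. exact: (periodic_solution_periodic c2v p2v int2v0 (@continuous_fun_cst _ 1) (@periodic_cst
    1)). Qed.

(** Lower bound of [periodic_solution_bounds] for [h = 1]; the factor [1 - expR (- 2 lambda L)] is
    positive because [lambda] is. *)
Lemma riccati_weight_gt0 x : 0 < p x.
Proof.
have := periodic_solution_bounds L0 c2v p2v int2v0 x (@continuous_fun_cst _ 1) (@periodic_cst 1)
    (fun=> ler01).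
rewrite primitive_cst mul1r int2v => /andP[H _].
have d : 0 < 1 - expR (- (2 * lambda * L)) by rewrite subr_gt0 expR_lt1 oppr_lt0 !mulr_gt0.
by rewrite -(pmulr_rgt0 _ d); apply: lt_le_trans H; rewrite mulr_gt0 ?expR_gt0.
Qed.

End weight.

Lemma primitive_gt0 f : continuous f -> (forall x, 0 < f x) -> 0 < primitive f L.
Proof.
move=> cf f0; have cn : {within `[0, L], continuous f} by exact: continuous_subspaceT.
have [c _ fc] := EVT_min L_ge0 cn.
apply: (@lt_le_trans _ _ (primitive (fun=> f c) L)); first by rewrite primitive_cst mulr_gt0.
by apply: le_primitive => //; exact: continuous_fun_cst.
Qed.

(** Testing with [p], where [p' = 2 v1 p - 1], completes the square: [(v2 - v1) p' - (v2^2 - v1^2) p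
    = - (v2 - v1) - (v2 - v1)^2 p]. *)
Lemma weak_riccati_identity b1 m1 l1 v1 b2 m2 l2 v2 : 0 < l1 ->
  weak_riccati L b1 m1 l1 v1 -> weak_riccati L b2 m2 l2 v2 ->
  let p := riccati_weight v1 in
  \int[mu]_(x in `[0, L]) (b2 x * p x) - \int[mu]_(x in `[0, L]) (b1 x * p x) =
  (m2 - m1) * primitive p L - (l2 - l1) * L
  - primitive (fun x => (v2 x - v1 x) ^+ 2 * p x) L.
Proof.
move=> l10 [cv1 pv1 vl1 H1] [cv2 pv2 vl2 H2] p.
have dp : forall x, is_derive x (1 : R) p (2 * v1 x * p x - 1) by exact: (riccati_weight_derive
    cv1 vl1 l10).
have cp : continuous p := is_derive_continuous dp.
have pp : periodic p L by exact: (riccati_weight_periodic cv1 pv1 vl1 l10).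
have cp' : continuous (fun x => 2 * v1 x * p x - 1) by continuity.
rewrite (H1 _ _ dp cp' pp) (H2 _ _ dp cp' pp).
have -> : (m2 - m1) * primitive p L - (l2 - l1) * L - primitive (fun x => (v2 x - v1 x) ^+ 2 * p
    x) L =
  primitive (fun x => (m2 - m1) * p x - (v2 x - v1 x) - (v2 x - v1 x) ^+ 2 * p x) L.
  rewrite !primitiveB ?primitiveZ//; try by continuity.
  by rewrite vl1 vl2; ring.
rewrite -primitiveB; try by continuity.
by congr (primitive _ L); apply/funext => x; ring.
Qed.

Section same_potential.
Variables (b : R -> R) (m1 m2 l1 l2 : R) (v1 v2 : R -> R).
Hypotheses (l10 : 0 < l1) (l20 : 0 < l2).
Hypotheses (R1 : weak_riccati L b m1 l1 v1) (R2 : weak_riccati L b m2 l2 v2).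

(** The difference [w] of the solutions satisfies [w' + V w = m1 - m2] weakly. As [V] has the
    positive mean [l1 + l2], the adjoint equation [g' = V g - h] has a periodic solution for each
    continuous periodic [h]. *)
Let V x := v1 x + v2 x.
Let w x := v1 x - v2 x.
Let cv1 : continuous v1. Proof. by case: R1. Qed.
Let cv2 : continuous v2. Proof. by case: R2. Qed.
Let cV : continuous V. Proof. by rewrite /V; continuity. Qed.
Let cw : continuous w. Proof. by rewrite /w; continuity. Qed.
Let pV : periodic V L. Proof. by case: R1 => _ pv1 _ _; case: R2 => _ pv2 _ _ x; rewrite /V pv1
    pv2. Qed.
Let pw : periodic w L. Proof. by case: R1 => _ pv1 _ _; case: R2 => _ pv2 _ _ x; rewrite /w pv1
    pv2. Qed.
Let J := (l1 + l2) * L.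
Let J0 : 0 < J. Proof. by rewrite mulr_gt0// addr_gt0. Qed.
Let intV : primitive V L = J.
Proof. by case: R1 => _ _ e1 _; case: R2 => _ _ e2 _; rewrite primitiveD// e1 e2 /J mulrDl. Qed.
Let intV0 : primitive V L != 0. Proof. by rewrite intV gt_eqF. Qed.
Let intw : primitive w L = (l1 - l2) * L.
Proof. by case: R1 => _ _ e1 _; case: R2 => _ _ e2 _; rewrite primitiveB// e1 e2 mulrBl. Qed.
Let den0 : 0 < 1 - expR (- J). Proof. by rewrite subr_gt0 expR_lt1 oppr_lt0. Qed.

(** In the difference of the two weak equations, the choice [g' = V g - h] cancels the quadratic
    terms and leaves [w h]. *)
Let duality (h : R -> R) : continuous h -> periodic h L ->
  primitive (fun x => w x * h x) L = (m1 - m2) * primitive (periodic_solution L V h) L.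
Proof.
move=> ch ph; set g := periodic_solution L V h.
have dg x : is_derive x (1 : R) g (V x * g x - h x) by exact: periodic_solution_derive.
have cg : continuous g by exact: is_derive_continuous dg.
have cg' : continuous (fun x => V x * g x - h x) by continuity.
have pg : periodic g L by exact: periodic_solution_periodic.
have [_ _ _ /(_ _ _ dg cg' pg) e1] := R1; have [_ _ _ /(_ _ _ dg cg' pg) e2] := R2.
have : primitive (fun x => m1 * g x + v1 x * (V x * g x - h x) - v1 x ^+ 2 * g x) L -
  primitive (fun x => m2 * g x + v2 x * (V x * g x - h x) - v2 x ^+ 2 * g x) L = 0.
  by rewrite -e1 e2 subrr.
rewrite -primitiveB; try by continuity.
rewrite -primitiveZ// => e; apply/eqP; rewrite -subr_eq0 -oppr_eq0 opprB -e.
rewrite -primitiveB; try by continuity.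
by apply/eqP; congr (primitive _ L); apply/funext => x; rewrite /w /V; ring.
Qed.

Variable M : R.
Hypotheses (m1M : m1 <= M) (m2M : m2 <= M).

(** Bound for the integral of [|V|], from [|V| <= 1 + v1^2 + v2^2] and the integral of [v^2], which
    is read off by testing with the constant 1. It depends on the two solutions through [M] alone,
    so the estimates below are uniform. *)
Let N := L * (1 + 2 * M) - 2 * \int[mu]_(x in `[0, L]) b x.

Let sqr_int m l v : weak_riccati L b m l v ->
  primitive (fun x => v x ^+ 2) L = m * L - \int[mu]_(x in `[0, L]) b x.
Proof.
move=> [cv pv _ H].
have := H (fun=> 1) (fun=> 0) (fun x => is_derive_fun_cst x 1) (@continuous_fun_cst _ 0)
    (@periodic_cst 1).
under eq_Rintegral do rewrite mulr1.
move=> ->; have -> : (fun x => m * 1 + v x * 0 - v x ^+ 2 * 1) = (fun x => m - v x ^+ 2).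
  by apply/funext => x; ring.
rewrite primitiveB; try by continuity.
by rewrite primitive_cst; ring.
Qed.

Let V_le_N : primitive (fun x => `|V x|) L <= N.
Proof.
apply: (@le_trans _ _ (primitive (fun x => 1 + v1 x ^+ 2 + v2 x ^+ 2) L)).
  apply: le_primitive => //; try by continuity.
  move=> x _; have h1 := sqr_ge0 (v1 x + v2 x - 1); have h2 := sqr_ge0 (v1 x + v2 x + 1).
  have h3 := sqr_ge0 (v1 x - v2 x); move: h1 h2 h3; rewrite !expr2 => h1 h2 h3.
  by rewrite ler_norml /V; apply/andP; split; lra.
rewrite !primitiveD; try by continuity.
rewrite primitive_cst (sqr_int R1) (sqr_int R2) /N.
have := ler_wpM2r L_ge0 m1M; have := ler_wpM2r L_ge0 m2M; lra.
Qed.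

Let g_lower : L ^+ 2 * expR (- N) <= primitive (periodic_solution L V (fun=> 1)) L.
Proof.
have -> : L ^+ 2 * expR (- N) = primitive (fun=> L * expR (- N)) L by rewrite primitive_cst; ring.
apply: le_primitive => //; first by continuity.
  exact: (continuous_periodic_solution cV intV0 (@continuous_fun_cst _ 1)).
move=> x _; have := periodic_solution_bounds L0 cV pV intV0 x (@continuous_fun_cst _ 1)
    (@periodic_cst 1) (fun=> ler01).
rewrite primitive_cst mul1r intV => /andP[H _].
have H1 : expR (- N) * L <= (1 - expR (- J)) * periodic_solution L V (fun=> 1) x.
  by apply: le_trans H; rewrite ler_wpM2r// ler_expR lerN2.
have S0 : 0 <= periodic_solution L V (fun=> 1) x.
  rewrite -(pmulr_rge0 _ den0); apply: le_trans H1.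
  by rewrite mulr_ge0// expR_ge0.
by rewrite mulrC; apply: le_trans H1 _; rewrite -[leRHS]mul1r ler_wpM2r.
Qed.

Let dl_eq : (l1 - l2) * L = (m1 - m2) * primitive (periodic_solution L V (fun=> 1)) L.
Proof.
rewrite -duality//; last exact: continuous_fun_cst.
by rewrite -intw; congr (primitive _ L); apply/funext => x; rewrite mulr1.
Qed.

(** Duality with [h = 1] reads [(l1 - l2) L = (m1 - m2) G], where [G >= L^2 expR (- N)] is positive;
    hence [l1 - l2] and [m1 - m2] have the same sign. *)
Lemma riccati_mono : l1 <= l2 -> m1 <= m2.
Proof.
move=> ll; rewrite leNgt; apply/negP => mm.
have g0 : 0 < primitive (periodic_solution L V (fun=> 1)) L.
  by apply: lt_le_trans g_lower; rewrite mulr_gt0 ?exprn_gt0 ?expR_gt0.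
have : 0 < (m1 - m2) * primitive (periodic_solution L V (fun=> 1)) L by apply: mulr_gt0 => //;
    rewrite subr_gt0.
by rewrite -dl_eq pmulr_lgt0// subr_gt0 ltNge ll.
Qed.

(** The relation [(l1 - l2) L = (m1 - m2) G] again, now with the quantitative lower bound on [G]. *)
Lemma riccati_lipschitz : `|m1 - m2| <= `|l1 - l2| * (expR N / L).
Proof.
set g := primitive (periodic_solution L V (fun=> 1)) L.
have H : `|l1 - l2| * L = `|m1 - m2| * g.
  rewrite -{1}(ger0_norm L_ge0) -normrM dl_eq normrM; congr (_ * _).
  by apply: ger0_norm; apply: le_trans g_lower; rewrite mulr_ge0 ?exprn_ge0 ?expR_ge0.
have : `|m1 - m2| * (L ^+ 2 * expR (- N)) <= `|l1 - l2| * L.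
  by rewrite H; apply: ler_wpM2l => //; exact: g_lower.
have e0 : 0 < expR N by exact: expR_gt0.
have : expR (- N) = (expR N)^-1 by rewrite expRN.
move=> ->; rewrite mulrA ler_pdivrMr// => H1.
rewrite mulrA ler_pdivlMr// -(ler_pM2r L0).
by move: H1; rewrite expr2; lra.
Qed.

Variable a : R.
Hypotheses (a0 : 0 < a) (al1 : a <= l1).

(** Duality with [h = w] bounds the integral of [w^2] by [C] times that of [|w|], which Young's
    inequality absorbs. Since [C] is proportional to [|m1 - m2|], the Lipschitz bound makes the
    result quadratic in [l1 - l2]; [a] keeps the denominator away from 0. *)
Lemma riccati_sqr_dist : primitive (fun x => (v1 x - v2 x) ^+ 2) L <=
  (expR N * (expR N / (1 - expR (- (a * L))))) ^+ 2 * L * (l1 - l2) ^+ 2.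
Proof.
set D := expR N / (1 - expR (- (a * L))).
have d0 : 0 < 1 - expR (- (a * L)) by rewrite subr_gt0 expR_lt1 oppr_lt0 mulr_gt0.
have D0 : 0 <= D by rewrite divr_ge0 ?expR_ge0// ltW.
pose n x : R := `|w x|.
have cn : continuous n by exact: continuous_fun_norm.
have pn : periodic n L by move=> x; rewrite /n pw.
have n0 x : 0 <= n x by exact: normr_ge0.
have In0 : 0 <= primitive n L by exact: primitive_ge0.
have S_ge0 (h : R -> R) x : continuous h -> periodic h L -> (forall y, 0 <= h y) -> 0 <=
    periodic_solution L V h x.
  move=> ch ph h0; rewrite -(pmulr_rge0 _ den0) -intV.
  have /andP[H _] := periodic_solution_bounds L0 cV pV intV0 x ch ph h0.
  by apply: le_trans H; rewrite mulr_ge0 ?expR_ge0// primitive_ge0.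
have Sn x : periodic_solution L V n x <= D * primitive n L.
  have /andP[_] := periodic_solution_bounds L0 cV pV intV0 x cn pn n0.
  rewrite intV => H.
  rewrite /D mulrAC ler_pdivlMr// mulrC.
  have S0 := S_ge0 n x cn pn n0.
  apply: (@le_trans _ _ ((1 - expR (- J)) * periodic_solution L V n x)).
    apply: ler_wpM2r => //; rewrite lerB// ler_expR lerN2 /J ler_wpM2r//.
    by rewrite (le_trans al1)// lerDl ltW.
  by apply: le_trans H _; rewrite ler_wpM2r// ler_expR.
(* Positivity of the solver is applied to [n + w] and [n - w]. *)
have Sw x : `|periodic_solution L V w x| <= D * primitive n L.
  have h1 : 0 <= periodic_solution L V (fun y => n y + -1 * w y) x.
    apply: S_ge0; [by continuity| |].
      by move=> y; rewrite pn pw.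
    by move=> y; rewrite mulN1r subr_ge0 ler_norm.
  have h2 : 0 <= periodic_solution L V (fun y => n y + w y) x.
    apply: S_ge0; [by continuity| |].
      by move=> y; rewrite pn pw.
    by move=> y; rewrite -[w y]opprK subr_ge0 /n -normrN ler_norm.
  have cw1 : continuous (fun y => -1 * w y) by continuity.
  rewrite (periodic_solutionD cV intV0 x cn cw1) (periodic_solutionZ cV intV0 _ x cw) in h1.
  rewrite (periodic_solutionD cV intV0 x cn cw) in h2.
  by have := Sn x; rewrite ler_norml => H; apply/andP; split; lra.
pose C := `|m1 - m2| * L * D.
have C0 : 0 <= C by exact: (mulr_ge0 (mulr_ge0 (normr_ge0 _) L_ge0) D0).
have PS : `|primitive (periodic_solution L V w) L| <= D * primitive n L * L.
  have cS := continuous_periodic_solution cV intV0 cw.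
  rewrite ler_norml -mulNr; apply/andP.
  rewrite -(primitive_cst (- (D * primitive n L)) L) -(primitive_cst (D * primitive n L) L).
  by split; apply: le_primitive => //; try exact: continuous_fun_cst;
    move=> x _; have := Sw x; rewrite ler_norml => /andP[].
have H : primitive (fun x => w x ^+ 2) L <= C * primitive n L.
  rewrite (_ : (fun x => w x ^+ 2) = (fun x => w x * w x)); last by apply/funext => x; rewrite
      expr2.
  rewrite (duality cw pw); apply: le_trans (ler_norm _) _; rewrite normrM.
  have -> : C * primitive n L = `|m1 - m2| * (D * primitive n L * L) by rewrite /C; ring.
  exact: ler_wpM2l.
have H2 : C * primitive n L <= (primitive (fun x => w x ^+ 2) L + C ^+ 2 * L) / 2.
  rewrite -primitiveZ// -[C ^+ 2 * L](primitive_cst (C ^+ 2)) -primitiveD; try by continuity.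
  rewrite mulrC -primitiveZ; last by continuity.
  apply: le_primitive => //; try by continuity.
  move=> x _; rewrite -[w x ^+ 2]real_normK ?num_real// -/(n x).
  have := sqr_ge0 (C - n x); rewrite sqrrB; lra.
have {H H2} : primitive (fun x => w x ^+ 2) L <= C ^+ 2 * L by lra.
move=> /le_trans; apply; rewrite [leRHS]mulrAC ler_wpM2r// /C.
have := riccati_lipschitz => lip.
have -> : (expR N * D) ^+ 2 * (l1 - l2) ^+ 2 = (`|l1 - l2| * (expR N / L) * L * D) ^+ 2.
  rewrite -[in LHS](real_normK (num_real (l1 - l2))).
  by field; rewrite gt_eqF.
apply: lerXn2r; rewrite ?nnegrE ?mulr_ge0 ?invr_ge0 ?expR_ge0 ?(ltW d0)//.
by apply: ler_wpM2r => //; apply: ler_wpM2r.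
Qed.

End same_potential.

(** The test function 1 gives the integral of [v^2], and Jensen's inequality bounds it below because
    [v] has mean [l]. *)
Lemma riccati_lower_bound b m l v : weak_riccati L b m l v ->
  \int[mu]_(x in `[0, L]) b x / L + l ^+ 2 <= m.
Proof.
move=> [cv pv vl H].
have := H (fun=> 1) (fun=> 0) (fun x => is_derive_fun_cst x 1) (@continuous_fun_cst _ 0)
    (@periodic_cst 1).
under eq_Rintegral do rewrite mulr1.
move=> ->; have -> : (fun x => m * 1 + v x * 0 - v x ^+ 2 * 1) = (fun x => m - v x ^+ 2).
  by apply/funext => x; ring.
rewrite primitiveB; try by continuity.
have : 0 <= primitive (fun x => (v x - l) ^+ 2) L.
  by apply: primitive_ge0 => //; [continuity|move=> x; exact: sqr_ge0].
have -> : (fun x => (v x - l) ^+ 2) = (fun x => v x ^+ 2 - 2 * l * v x + l ^+ 2).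
  by apply/funext => x; ring.
rewrite primitiveD ?primitiveB ?primitiveZ ?primitive_cst ?vl; try by continuity.
move=> H2; rewrite -lerBrDr ler_pdivrMr// mulrBl; lra.
Qed.

(* Differentiating the tangency of [m lambda >= c lambda] at [l0]. *)
Lemma riccati_first_order b (m : R -> R) (v : R -> R -> R) c l0 : 0 < l0 ->
  (forall l, 0 < l -> weak_riccati L b (m l) l (v l)) ->
  (forall l, 0 < l -> c * l <= m l) -> m l0 = c * l0 ->
  c * primitive (riccati_weight (v l0)) L = L.
Proof.
move=> l00 Rv cm ml0; set p := riccati_weight (v l0).
have [cv pv vl _] := Rv _ l00.
have cp : continuous p by exact: (riccati_weight_continuous cv vl l00).
have [B B0 pB] := continuous_segment_bounded 0 L cp.
set A := primitive p L.
(* With these, the constants of [riccati_sqr_dist] are uniform for [l] between [l0 / 2] and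
   [2 * l0]. *)
pose M := m (2 * l0); pose a := l0 / 2.
have mono l1 l2 : 0 < l1 -> l1 <= l2 -> m l1 <= m l2.
  move=> l10 l12; have l20 := lt_le_trans l10 l12.
  by apply: (riccati_mono l10 l20 (Rv _ l10) (Rv _ l20) (M := Num.max (m l1) (m l2))) => //;
     rewrite le_max lexx ?orbT.
pose K := B * ((expR (L * (1 + 2 * M) - 2 * \int[mu]_(x in `[0, L]) b x) *
   (expR (L * (1 + 2 * M) - 2 * \int[mu]_(x in `[0, L]) b x) / (1 - expR (- (a * L))))) ^+ 2 * L).
have K0 : 0 <= K by rewrite mulr_ge0// mulr_ge0// sqr_ge0.
have a0 : 0 < a by rewrite divr_gt0.
(* The identity for one potential at [l] and [l0], with a quadratic remainder. Division by [l - l0]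
   of either sign yields the two opposite inequalities. *)
have main l : a <= l <= 2 * l0 -> c * A * (l - l0) <= (l - l0) * L + K * (l - l0) ^+ 2.
  move=> /andP[al l2]; have l_0 := lt_le_trans a0 al.
  have mlM : m l <= M by exact: mono.
  have ml0M : m l0 <= M by apply: mono => //; lra.
  have := riccati_sqr_dist l_0 l00 (Rv _ l_0) (Rv _ l00) mlM ml0M a0 al => D.
  have /= := weak_riccati_identity l00 (Rv _ l00) (Rv _ l_0); rewrite subrr -/p -/A => /esym E.
  have A0 : 0 <= A by apply: primitive_ge0 => // x; apply/ltW; exact: (riccati_weight_gt0 cv pv
      vl l00).
  have cvl : continuous (v l) by case: (Rv _ l_0).
  have H : primitive (fun x => (v l x - v l0 x) ^+ 2 * p x) L <= K * (l - l0) ^+ 2.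
    rewrite /K -mulrA; apply: le_trans (ler_wpM2l B0 D); rewrite -primitiveZ; last by continuity.
    apply: le_primitive => //; try by continuity.
    move=> x xL; rewrite [leRHS]mulrC ler_wpM2l ?sqr_ge0//.
    by apply: le_trans (pB _ xL); exact: ler_norm.
  have cml : c * l <= m l by exact: cm.
  have : (c * l - c * l0) * A <= (m l - m l0) * A by rewrite ler_wpM2r// ml0 lerB.
  lra.
apply/le_anti/andP; split; apply/ler_addgt0Pr => e e0.
(* The first bound keeps [l0 + h] in the window of [main], the second makes the remainder at most
   [e]; adding 1 covers [K = 0]. *)
- pose h := Num.min l0 (e / (K + 1)).
  have h0 : 0 < h by rewrite lt_min l00 divr_gt0// ltr_wpDl.
  have hl : h <= l0 by rewrite ge_min lexx.
  have hK : K * h <= e.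
    apply: (@le_trans _ _ ((K + 1) * h)); first by rewrite ler_wpM2r ?lerDl// ltW.
    rewrite mulrC -ler_pdivlMr ?ltr_wpDl//.
    by rewrite /h ge_min lexx orbT.
  have := main (l0 + h); have -> : l0 + h - l0 = h by ring.
  rewrite /a => H.
  have {}H : c * A * h <= (L + K * h) * h.
    have : c * A * h <= h * L + K * h ^+ 2 by apply: H; apply/andP; split; lra.
    by rewrite expr2; lra.
  have {}H : c * A <= L + K * h by rewrite -(ler_pM2r h0).
  lra.
- pose h := Num.min (l0 / 2) (e / (K + 1)).
  have h0 : 0 < h by rewrite lt_min a0 divr_gt0// ltr_wpDl.
  have hl : h <= l0 / 2 by rewrite ge_min lexx.
  have hK : K * h <= e.
    apply: (@le_trans _ _ ((K + 1) * h)); first by rewrite ler_wpM2r ?lerDl// ltW.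
    rewrite mulrC -ler_pdivlMr ?ltr_wpDl//.
    by rewrite /h ge_min lexx orbT.
  have := main (l0 - h); have -> : l0 - h - l0 = - h by ring.
  rewrite /a => H.
  have {}H : (L - K * h) * h <= c * A * h.
    have : c * A * (- h) <= - h * L + K * (- h) ^+ 2 by apply: H; apply/andP; split; lra.
    by rewrite sqrrN expr2; lra.
  have {}H : L - K * h <= c * A by rewrite -(ler_pM2r h0).
  lra.
Qed.

End riccati_comparison.

(** * Perron eigenfunctions *)

Section perron.
Context {R : realType}.
Implicit Types (f g h : R -> R) (x y : R).

Lemma geometric_small (A theta e : R) : 0 <= theta < 1 -> 0 < e -> exists n, A * theta ^+ n <= e.
Proof.
move=> /andP[t0 t1] e0; have A0 : 0 < `|A| + 1 by rewrite ltr_wpDl.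
have : (theta ^+ n) @[n --> \oo] --> (0 : R) by apply: cvg_expr; rewrite ger0_norm.
move/cvgrPdist_le => /(_ (e / (`|A| + 1))); rewrite divr_gt0// => /(_ isT)[n _ /(_ n (leqnn _))].
rewrite sub0r normrN ger0_norm ?exprn_ge0// ler_pdivlMr// => H; exists n.
apply: le_trans H; rewrite mulrC ler_wpM2l ?exprn_ge0//.
by rewrite (le_trans (ler_norm _))// lerDl.
Qed.

Lemma le0_of_geometric (a A theta : R) : 0 <= theta < 1 -> (forall n, a <= A * theta ^+ n) -> a
    <= 0.
Proof.
move=> t H; apply/ler_addgt0Pl => e e0; rewrite addr0.
have [n Hn] := geometric_small A t e0; exact: le_trans (H n) Hn.
Qed.

Lemma uniform_approx_continuous f : (forall e, 0 < e -> exists2 g, continuous g & forall x, `|g x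
    - f x| <= e) ->
  continuous f.
Proof.
move=> H x; apply/cvgrPdist_le => e e0; have [g cg gf] := H (e / 3) (divr_gt0 e0 (ltr0Sn _ 2)).
have := cg x; move/cvgrPdist_le => /(_ (e / 3) (divr_gt0 e0 (ltr0Sn _ 2))).
apply: filterS => t gt.
have -> : f x - f t = - (g x - f x) + (g x - g t) + (g t - f t) by ring.
apply: le_trans (ler_normD _ _) _; have h1 := gf t.
apply: le_trans (lerD (ler_normD _ _) (lexx _)) _; rewrite normrN.
have h2 := gf x; have : e = e / 3 + e / 3 + e / 3 by field.
by move=> ->; rewrite !lerD.
Qed.

Variables (L : R) (L0 : 0 < L).

Let I f := primitive f L.

Section operator.
Variables (T : (R -> R) -> R -> R) (c C : R).
Hypotheses (c0 : 0 < c) (C0 : 0 < C).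
Hypothesis T_cont : forall f, continuous f -> periodic f L -> continuous (T f).
Hypothesis T_per : forall f, continuous f -> periodic f L -> periodic (T f) L.
Hypothesis TD : forall f g x, continuous f -> continuous g -> periodic f L -> periodic g L ->
  T (fun y => f y + g y) x = T f x + T g x.
Hypothesis TZ : forall a f x, continuous f -> periodic f L -> T (fun y => a * f y) x = a * T f x.
Hypothesis T_bounds : forall f x, continuous f -> periodic f L -> (forall y, 0 <= f y) ->
  c * I f <= T f x <= C * I f.

(** Power method: the eigenfunction is the limit of these iterates normalized at 0. *)
Let f (n : nat) : R -> R := iter n T (fun=> 1).

Let f_cp n : continuous (f n) /\ periodic (f n) L.
Proof.
elim: n => [|n [cf pf]]; first by split=> //; exact: continuous_fun_cst.
by split; [exact: T_cont|exact: T_per].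
Qed.
Let cf n : continuous (f n). Proof. by have [] := f_cp n. Qed.
Let pf n : periodic (f n) L. Proof. by have [] := f_cp n. Qed.

Arguments cf : clear implicits.
Arguments pf : clear implicits.

Let f0 n x : 0 < f n x.
Proof.
elim: n x => [|n IH] x; first exact: ltr01.
have /andP[H _] := T_bounds x (cf n) (pf n) (fun y => ltW (IH y)).
by apply: lt_le_trans H; rewrite mulr_gt0// primitive_gt0.
Qed.

Let If0 n : 0 < I (f n). Proof. exact: primitive_gt0. Qed.

Let cC : c <= C.
Proof.
have := T_bounds 0 (cf 0) (pf 0) (fun y => ltW (f0 0 y)) => /andP[h1 h2].
by rewrite -(ler_pM2r (If0 0)); exact: le_trans h1 h2.
Qed.

Let d := c / C.
Let d0 : 0 < d. Proof. exact: divr_gt0. Qed.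
Let d1 : d <= 1. Proof. by rewrite ler_pdivrMr// mul1r. Qed.
Let theta := 1 - d.
Let theta01 : 0 <= theta < 1.
Proof. by rewrite /theta; have := d0; have := d1; lra. Qed.

(** [q] brackets the ratio [f n.+1 / f n], and [s] is the height of its mean with weight [f n] above
    the lower end. Each end moves towards this mean by the fraction [d] of its distance, so the
    width is multiplied by [theta = 1 - d]. *)
Let step (n : nat) (q : R * R) : R * R :=
  let s := I (f n.+1) / I (f n) - q.1 in (q.1 + d * s, q.2 - d * (q.2 - q.1 - s)).

Fixpoint perron_bracket n : R * R := if n is k.+1 then step k (perron_bracket k) else (c * L, C *
    L).

Let lo n := (perron_bracket n).1.
Let hi n := (perron_bracket n).2.

(** [T h] is at least [c * I h], while [f n.+1 = T (f n)] is at most [C * I (f n)]: the image of a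
    nonnegative function dominates a definite multiple of the next iterate. *)
Let gain n h : continuous h -> periodic h L -> (forall y, 0 <= h y) ->
  forall x, d * (I h / I (f n)) * f n.+1 x <= T h x.
Proof.
move=> ch ph h0 x.
have /andP[H1 _] := T_bounds x ch ph h0; apply: le_trans H1.
have /andP[_ H2] := T_bounds x (cf n) (pf n) (fun y => ltW (f0 n y)).
have Ih : 0 <= I h by apply: primitive_ge0 => //; exact: ltW.
have -> : c * I h = d * (I h / I (f n)) * (C * I (f n)).
  by rewrite /d; field; rewrite gt_eqF// gt_eqF.
by apply: ler_wpM2l => //; rewrite mulr_ge0// ?divr_ge0// ltW.
Qed.

(** Induction: [gain] is applied to [f n.+1 - lo n * f n] and [hi n * f n - f n.+1], both
    nonnegative by the previous bracket. *)
Let bracketP n : (forall x, lo n * f n x <= f n.+1 x <= hi n * f n x) /\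
  hi n - lo n = (C * L - c * L) * theta ^+ n.
Proof.
elim: n => [|n [IH IHd]].
  split; last by rewrite /hi /lo/= expr0 mulr1.
  move=> x; rewrite /lo /hi/= !mulr1.
  have := T_bounds x (cf 0) (pf 0) (fun y => ltW (f0 0 y)).
  by rewrite /I primitive_cst mul1r.
have Inz : I (f n) != 0 by rewrite gt_eqF.
have Tn : T (f n) = f n.+1 by [].
have Tn1 : T (f n.+1) = f n.+2 by [].
split; last first.
  rewrite exprS mulrCA -IHd /hi /lo /theta /= -/(lo n) -/(hi n); field.
  exact: Inz.
move=> x; pose h1 y := f n.+1 y + - lo n * f n y; pose h2 y := hi n * f n y + -1 * f n.+1 y.
have c1 a m : continuous (fun y => a * f m y) by apply: continuous_funM => //; exact:
    continuous_fun_cst.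
have p1 a m : periodic (fun y => a * f m y) L by move=> y; rewrite pf.
have H1 := @gain n h1 (continuous_funD (cf _) (c1 _ _)).
have H2 := @gain n h2 (continuous_funD (c1 _ _) (c1 _ _)).
have {}H1 : d * (I h1 / I (f n)) * f n.+1 x <= T h1 x.
  apply: H1 => y; first by rewrite /h1 !pf.
  by rewrite /h1 mulNr subr_ge0; have /andP[] := IH y.
have {}H2 : d * (I h2 / I (f n)) * f n.+1 x <= T h2 x.
  apply: H2 => y; first by rewrite /h2 !pf.
  by rewrite /h2 mulN1r subr_ge0; have /andP[] := IH y.
move: H1 H2; rewrite /h1 /h2 /I !TD ?TZ ?primitiveD ?primitiveZ// -!/(I _) Tn Tn1.
have -> : (I (f n.+1) + - lo n * I (f n)) / I (f n) = I (f n.+1) / I (f n) - lo n by field.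
have -> : (hi n * I (f n) + -1 * I (f n.+1)) / I (f n) = hi n - I (f n.+1) / I (f n) by field.
rewrite /lo /hi /= -/(lo n) -/(hi n) => H1 H2; apply/andP; split; lra.
Qed.

Let ratio_in n : lo n <= I (f n.+1) / I (f n) <= hi n.
Proof.
have [H _] := bracketP n.
rewrite ler_pdivlMr// ler_pdivrMr//.
have cc a : continuous (fun y => a * f n y) by apply: continuous_funM => //; exact:
    continuous_fun_cst.
by rewrite /I -!primitiveZ// !le_primitive//; try exact: ltW; move=> y _; have /andP[] := H y.
Qed.

Let lo_hi n : lo n <= hi n.
Proof. by have /andP[/le_trans H] := ratio_in n; exact: H. Qed.

Let lo_mono n : lo n <= lo n.+1.
Proof.
rewrite [leRHS]/lo /= -/(lo n) lerDl mulr_ge0 ?(ltW d0)// subr_ge0.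
by have /andP[] := ratio_in n.
Qed.

Let hi_mono n : hi n.+1 <= hi n.
Proof.
rewrite [leLHS]/hi /= -/(lo n) -/(hi n) gerBl mulr_ge0 ?(ltW d0)//.
by have /andP[_] := ratio_in n; lra.
Qed.

Let lo_homo m n : (m <= n)%N -> lo m <= lo n.
Proof. by move/subnK <-; elim: (n - m)%N => // k; rewrite addSn => /le_trans; apply. Qed.

Let hi_homo m n : (m <= n)%N -> hi n <= hi m.
Proof. by move/subnK <-; elim: (n - m)%N => // k IH; rewrite addSn; exact: le_trans (hi_mono _)
    IH. Qed.

Let lo0 n : c * L <= lo n. Proof. exact: (lo_homo (leq0n n)). Qed.
Let lo_gt0 n : 0 < lo n. Proof. by apply: lt_le_trans (lo0 n); rewrite mulr_gt0. Qed.

Let g n x := f n x / f n 0.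

Let cg n : continuous (g n).
Proof. by apply: continuous_funM => //; exact: continuous_fun_cst. Qed.
Let pg n : periodic (g n) L. Proof. by move=> x; rewrite /g pf. Qed.

Arguments cg : clear implicits.
Arguments pg : clear implicits.

Let g_bounds n x : d <= g n x <= C / c.
Proof.
case: n => [|n]; first by rewrite /g divr1 d1 ler_pdivlMr// mul1r.
have := T_bounds x (cf n) (pf n) (fun y => ltW (f0 n y)).
have := T_bounds 0 (cf n) (pf n) (fun y => ltW (f0 n y)).
rewrite -[T (f n)]/(f n.+1) => /andP[h1 h2] /andP[h3 h4].
have p0 := f0 n.+1 0; have In := If0 n.
rewrite /g ler_pdivlMr// ler_pdivrMr//; apply/andP; split.
  rewrite /d mulrAC ler_pdivrMr// [leRHS]mulrC.
  apply: le_trans (ler_wpM2l (ltW c0) h2) _.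
  by rewrite mulrCA ler_wpM2l// ltW.
rewrite mulrAC ler_pdivlMr// mulrC.
apply: le_trans (ler_wpM2l (ltW c0) h4) _.
by rewrite mulrCA ler_wpM2l// ltW.
Qed.

Let K := C / c * ((C * L - c * L) / (c * L)).
Let K0 : 0 <= K.
Proof. by rewrite !mulr_ge0 ?invr_ge0 ?mulr_ge0 ?(ltW c0) ?(ltW C0) ?(ltW L0)// -mulrBl mulr_ge0
    ?subr_ge0 ?(ltW L0). Qed.

(** [g n.+1 / g n] is a quotient of two ratios in the bracket, so it lies between [lo n / hi n] and
    [hi n / lo n], and the bracket shrinks geometrically. *)
Let g_step n x : `|g n.+1 x - g n x| <= K * theta ^+ n.
Proof.
have [B D] := bracketP n.
have /andP[x1 x2] := B x; have /andP[y1 y2] := B 0.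
have fx := f0 n x; have fy := f0 n 0; have fy' := f0 n.+1 0; have l0 := lo_gt0 n.
have /andP[gd gC] := g_bounds n x; have gx0 : 0 < g n x by exact: lt_le_trans gd.
have H : g n x * ((hi n - lo n) / lo n) <= K * theta ^+ n.
  rewrite /K -mulrA; apply: ler_pM => //; first exact: ltW.
    by rewrite divr_ge0 ?subr_ge0// ltW.
  rewrite D mulrAC ler_wpM2r//.
    by rewrite exprn_ge0//; case/andP: theta01.
  rewrite ler_wpM2l// -?mulrBl ?mulr_ge0 ?subr_ge0 ?(ltW L0)//.
  by rewrite lef_pV2 ?posrE// mulr_gt0.
apply: le_trans H.
have l1 : g n.+1 x * lo n <= hi n * g n x.
  have -> : g n.+1 x * lo n = f n.+1 x * lo n / f n.+1 0 by rewrite /g; ring.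
  rewrite ler_pdivrMr//.
  apply: (@le_trans _ _ (hi n * f n x * lo n)); first by rewrite ler_wpM2r// ltW.
  have -> : hi n * f n x * lo n = hi n * g n x * (lo n * f n 0) by rewrite /g; field; rewrite
      gt_eqF.
  by rewrite ler_wpM2l// mulr_ge0 ?(ltW gx0)// (le_trans (ltW l0)).
have l2 : lo n * g n x <= g n.+1 x * hi n.
  have -> : g n.+1 x * hi n = f n.+1 x * hi n / f n.+1 0 by rewrite /g; ring.
  rewrite ler_pdivlMr//.
  apply: (@le_trans _ _ (lo n * f n x * hi n)); last first.
    by rewrite ler_wpM2r// (le_trans (ltW l0)).
  have -> : lo n * f n x * hi n = lo n * g n x * (hi n * f n 0) by rewrite /g; field; rewrite
      gt_eqF.
  by rewrite ler_wpM2l// mulr_ge0 ?(ltW gx0)// ltW.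
have lh := lo_hi n; rewrite mulrA ler_pdivlMr// -{1}(ger0_norm (ltW l0)) -normrM ler_norml.
apply/andP; split; last by lra.
have h0 : 0 < hi n by exact: lt_le_trans lh.
have H : lo n * g n x * lo n <= g n.+1 x * lo n * hi n.
  by rewrite [leRHS]mulrAC ler_wpM2r// ltW.
rewrite -(ler_pM2r h0).
have : 0 <= g n x * (hi n - lo n) * (hi n - lo n) by rewrite -mulrA mulr_ge0 ?(ltW gx0)// -expr2
    sqr_ge0.
by move: H; lra.
Qed.

(** Tail of the geometric series of the [K * theta ^+ n]: added to [g n] it gives a decreasing
    sequence, subtracted an increasing one. *)
Let err n := K / (1 - theta) * theta ^+ n.

Let t1 : 0 < 1 - theta. Proof. by rewrite subr_gt0; case/andP: theta01. Qed.

Let errS n : err n - err n.+1 = K * theta ^+ n.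
Proof. by rewrite /err exprS; field; rewrite gt_eqF. Qed.

Let up n x := g n x + err n.
Let dn n x := g n x - err n.

Let up_mono n x : up n.+1 x <= up n x.
Proof. by rewrite /up; have := g_step n x; rewrite -errS ler_norml => /andP[]; lra. Qed.

Let dn_mono n x : dn n x <= dn n.+1 x.
Proof. by rewrite /dn; have := g_step n x; rewrite -errS ler_norml => /andP[]; lra. Qed.

Let err0 n : 0 <= err n.
Proof. by rewrite mulr_ge0 ?divr_ge0 ?(ltW t1)// exprn_ge0//; case/andP: theta01. Qed.

Let dn_up m n x : dn m x <= up n x.
Proof.
have U k j : up (k + j) x <= up j x.
  by elim: k => // k IH; rewrite addSn; exact: le_trans (up_mono _ _) IH.
have D k j : dn j x <= dn (k + j) x.
  by elim: k => // k IH; rewrite addSn; exact: le_trans IH (dn_mono _ _).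
apply: le_trans (D n m) _; apply: le_trans (U m n); rewrite addnC.
by rewrite /dn /up; have := err0 (m + n); lra.
Qed.

(** The limit of [g n], obtained as an infimum with the explicit uniform error [err n]. *)
Let psi x := inf [set up n x | n in setT].

Let psi_g n x : `|g n x - psi x| <= err n.
Proof.
have h : dn n x <= psi x.
  apply: lb_le_inf; first by exists (up 0 x), 0%N.
  by move=> _ [m _ <-].
have h' : psi x <= up n x.
  apply: ge_inf; last by exists n.
  by exists (dn 0 x) => _ [m _ <-].
by rewrite ler_norml; move: h h'; rewrite /dn /up; lra.
Qed.

(** [psi] is a uniform limit of continuous functions and [r] the common limit of the brackets. The
    residual [T psi - r psi] is bounded by a fixed multiple of [theta ^+ n] for every [n], hence
    zero. *)
Lemma perron_eigenfunction :
  exists (psi : R -> R) (r : R),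
  [/\ continuous psi, periodic psi L, forall x, 0 < psi x, 0 < r & forall x, T psi x = r * psi x].
Proof.
have cpsi : continuous psi.
  apply: uniform_approx_continuous => e e0.
  have [n en] := geometric_small (K / (1 - theta)) theta01 e0.
  by exists (g n) => // x; exact: le_trans (psi_g n x) en.
have ppsi : periodic psi L.
  move=> x; rewrite /psi; congr inf; apply/seteqP; split=> _ [n _ <-]; exists n => //;
    by rewrite /up pg.
pose r := inf [set hi n | n in setT].
have lohi m n : lo m <= hi n.
  apply: le_trans (lo_homo (leq_addr n m)) _.
  by apply: le_trans (lo_hi _) _; apply: hi_homo; exact: leq_addl.
have rlo n : lo n <= r.
  apply: lb_le_inf; first by exists (hi 0), 0%N.
  by move=> _ [m _ <-].
have rhi n : r <= hi n.
  apply: ge_inf; last by exists n.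
  by exists (lo 0) => _ [m _ <-].
have r0 : 0 < r by exact: lt_le_trans (lo_gt0 0) (rlo 0).
have T_ge0 h : continuous h -> periodic h L -> (forall y, 0 <= h y) -> forall x, 0 <= T h x.
  move=> ch ph h0 x; have /andP[H _] := T_bounds x ch ph h0.
  by apply: le_trans H; rewrite mulr_ge0 ?(ltW c0)// primitive_ge0// ltW.
(* Uniform bound deduced from the positivity of [T] on [e + h] and [e - h]. *)
have Tsmall h e : continuous h -> periodic h L -> (forall x, `|h x| <= e) -> forall x, `|T h x|
    <= e * (C * L).
  move=> ch ph he x.
  have ce : continuous (fun _ : R => e) by exact: continuous_fun_cst.
  have c1 : continuous (fun y => -1 * h y) by continuity.
  have p1 : periodic (fun y => -1 * h y) L by move=> y; rewrite ph.
  have e0 : 0 <= e by exact: le_trans (he 0).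
  have /andP[_ Te] := T_bounds x ce (fun=> erefl) (fun=> e0).
  have H1 : 0 <= T (fun y => e + h y) x.
    apply: T_ge0 => [||y]; [exact: continuous_funD|by move=> y; rewrite ph|].
    by have := he y; rewrite ler_norml => /andP[]; lra.
  have H2 : 0 <= T (fun y => e + -1 * h y) x.
    apply: T_ge0 => [||y]; [exact: continuous_funD|by move=> y; rewrite ph|].
    by have := he y; rewrite ler_norml => /andP[]; lra.
  rewrite TD// in H1; rewrite TD// TZ// in H2; rewrite /I primitive_cst in Te.
  by rewrite ler_norml; apply/andP; split; lra.
exists psi, r; split => //.
  move=> x; apply: (@lt_le_trans _ _ d) => //; rewrite -subr_le0.
  apply: (@le0_of_geometric _ (K / (1 - theta)) theta) => // n.
  by have /andP[h _] := g_bounds n x; have := psi_g n x; rewrite -/(err n) ler_norml => /andP[];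
      lra.
move=> x; apply/eqP; rewrite -subr_eq0 -normr_le0.
(* The three terms account for [T psi - T (g n)], for the error on the eigenvalue, and for
   [g n.+1 - psi]. *)
pose E := K / (1 - theta) * (C * L) + (C * L - c * L) * (C / c) + r * (K / (1 - theta)).
apply: (@le0_of_geometric _ E theta) => // n.
have -> : E * theta ^+ n = err n * (C * L) + (hi n - lo n) * (C / c) + r * err n.
  by have [_ ->] := bracketP n; rewrite /E /err; ring.
pose rho := f n.+1 0 / f n 0.
have Tg : T (g n) x = rho * g n.+1 x.
  have -> : g n = (fun y => (f n 0)^-1 * f n y) by apply/funext => y; rewrite /g mulrC.
  rewrite TZ// -[T (f n)]/(f n.+1) /rho /g; field.
  by rewrite !gt_eqF.
have rhoB : lo n <= rho <= hi n.
  by have [/(_ 0) B _] := bracketP n; rewrite /rho ler_pdivlMr// ler_pdivrMr.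
have Td : T psi x - T (g n) x = T (fun y => psi y + -1 * g n y) x.
  rewrite TD ?TZ//; [by ring|by continuity|by move=> y; rewrite pg].
have c1 : continuous (fun y => psi y + -1 * g n y) by continuity.
have p1 : periodic (fun y => psi y + -1 * g n y) L by move=> y; rewrite pg ppsi.
have Hs y : `|psi y + -1 * g n y| <= err n by rewrite mulN1r distrC; exact: psi_g.
have := Tsmall _ _ c1 p1 Hs x; rewrite -Td => S1.
have -> : T psi x - r * psi x = (T psi x - T (g n) x) + (rho - r) * g n.+1 x + r * (g n.+1 x -
    psi x).
  by rewrite Tg; ring.
apply: le_trans (ler_normD _ _) _; apply: lerD.
  apply: le_trans (ler_normD _ _) _; apply: lerD => //.
  rewrite normrM; have /andP[gd gC] := g_bounds n.+1 x; apply: ler_pM => //.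
    by rewrite ler_norml; have := rlo n; have := rhi n; lra.
  by rewrite ger0_norm// (le_trans (ltW d0)).
rewrite normrM (gtr0_norm r0) ler_wpM2l ?(ltW r0)//.
apply: le_trans (psi_g n.+1 x) _; have := errS n.
have : 0 <= K * theta ^+ n by rewrite mulr_ge0// exprn_ge0//; case/andP: theta01.
lra.
Qed.

End operator.
End perron.

(** * Existence of the principal eigenvalue *)

Section existence.
Context {R : realType}.
Implicit Types (f g h b : R -> R) (x y w l m : R).

Local Notation mu := (@lebesgue_measure R).

Variables (L : R) (L0 : 0 < L).

Let I f := primitive f L.

Section constant_coefficient.
Variables (w : R) (w0 : w != 0).
Let S := periodic_solution L (fun=> w).
Let cw : continuous (fun _ : R => w). Proof. exact: continuous_fun_cst. Qed.
Let pw : periodic (fun _ : R => w) L. Proof. by []. Qed.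
Let iw : primitive (fun=> w) L = w * L. Proof. exact: primitive_cst. Qed.
Let iw0 : primitive (fun=> w) L != 0. Proof. by rewrite iw mulf_neq0// gt_eqF. Qed.

Lemma constant_solver_cst c x : S (fun=> c) x = c / w.
Proof.
have den : 1 - expR (- (w * L)) != 0.
  rewrite subr_eq0 eq_sym -expR0; apply: contra iw0 => /eqP/expR_inj/eqP.
  by rewrite oppr_eq0 iw.
have E y : primitive (fun z => expR (- primitive (fun=> w) z) * c) y = c / w * (1 - expR (- (w *
    y))).
  have cf : continuous (fun z => expR (- primitive (fun=> w) z) * c).
    by under eq_fun do rewrite primitive_cst; continuity.
  have dF z : is_derive z (1 : R) (fun z => - c / w * expR (- (w * z))) (expR (- primitive (fun=>
      w) z) * c).
    apply: is_derive_eq (is_derive_funZ _ (is_derive_fun_expR (is_derive_funN (is_derive_funZ w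
        (is_derive_fun_id z))))) _.
    by rewrite primitive_cst; field.
  by rewrite (primitive_unique _ cf dF) mulr0 oppr0 expR0; ring.
rewrite /S /periodic_solution !E !primitive_cst (expRN (w * x)).
have ? : expR (w * x) != 0 by rewrite gt_eqF// expR_gt0.
by field; do ?[apply/andP; split].
Qed.

(** The solver has the sign of [w], since [1 - expR (- w L)] does; the factor [Num.sg w] covers both
    signs, which occur in the two factors of [green]. *)
Lemma constant_solver_bounds : exists c C, [/\ 0 < c, 0 < C &
  forall f x, continuous f -> periodic f L -> (forall y, 0 <= f y) ->
  c * I f <= Num.sg w * S f x <= C * I f].
Proof.
pose N := primitive (fun=> `|w|) L; pose k := Num.sg w * (1 - expR (- (w * L))).
have sg2 : Num.sg w * Num.sg w = 1 by rewrite -expr2 sqr_sg w0.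
have k0 : 0 < k.
  rewrite /k; case: (ltrgt0P w) w0 => // ws _.
    by rewrite gtr0_sg// mul1r subr_gt0 expR_lt1 oppr_lt0 mulr_gt0.
  by rewrite ltr0_sg// mulN1r opprB subr_gt0 expR_gt1 oppr_gt0 pmulr_llt0.
exists (expR (- N) / k), (expR N / k); split; [by rewrite divr_gt0 ?expR_gt0..|].
move=> f x cf pf f0.
have := periodic_solution_bounds L0 cw pw iw0 x cf pf f0; rewrite iw -/N -/(I f) -/(S f x).
have -> : (1 - expR (- (w * L))) * S f x = (Num.sg w * S f x) * k.
  by rewrite /k mulrACA sg2 mul1r mulrC.
by rewrite ![_ / k * _]mulrAC ler_pdivrMr// ler_pdivlMr.
Qed.

End constant_coefficient.

Section green.
Variables (l m : R) (l0 : 0 < l) (lm : l < m).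

Let V1 (x : R) := m - l.
Let V2 (x : R) := - (m + l).
Let S1 := periodic_solution L V1.
Let S2 := periodic_solution L V2.

(* The positive inverse of [- d^2 - 2 l d + (m^2 - l^2)] on periodic functions,
   through the factorization [(m - l - d) (m + l + d)]. *)
Definition green f x := - S2 (S1 f) x.

Let w1 : m - l != 0. Proof. by rewrite gt_eqF// subr_gt0. Qed.
Let w2 : - (m + l) != 0. Proof. by rewrite oppr_eq0 gt_eqF// addr_gt0// (lt_trans l0). Qed.
Let c1 : continuous V1. Proof. exact: continuous_fun_cst. Qed.
Let c2 : continuous V2. Proof. exact: continuous_fun_cst. Qed.
Let p1 : periodic V1 L. Proof. by []. Qed.
Let p2 : periodic V2 L. Proof. by []. Qed.
Let i1 : primitive V1 L != 0. Proof. by rewrite primitive_cst mulf_neq0// gt_eqF. Qed.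
Let i2 : primitive V2 L != 0. Proof. by rewrite primitive_cst mulf_neq0// gt_eqF. Qed.
Let cS1 f : continuous f -> continuous (S1 f). Proof. exact: continuous_periodic_solution. Qed.
Let pS1 f : continuous f -> periodic f L -> periodic (S1 f) L. Proof. exact:
    periodic_solution_periodic. Qed.

Lemma green_continuous f : continuous f -> continuous (green f).
Proof. by move=> cf; apply: continuous_funN; apply: continuous_periodic_solution => //; exact:
    cS1. Qed.

Lemma green_periodic f : continuous f -> periodic f L -> periodic (green f) L.
Proof.
move=> cf pf x; rewrite /green; congr (- _).
by apply: periodic_solution_periodic => //; [exact: cS1|exact: pS1].
Qed.

Lemma greenD f g x : continuous f -> continuous g ->
  green (fun y => f y + g y) x = green f x + green g x.
Proof.
move=> cf cg; rewrite /green -opprD; congr (- _).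
rewrite (_ : S1 _ = fun y => S1 f y + S1 g y); last first.
  by apply/funext => y; exact: periodic_solutionD.
by apply: periodic_solutionD => //; exact: cS1.
Qed.

Lemma greenZ a f x : continuous f -> green (fun y => a * f y) x = a * green f x.
Proof.
move=> cf; rewrite /green mulrN; congr (- _).
rewrite (_ : S1 _ = fun y => a * S1 f y); last first.
  by apply/funext => y; exact: periodic_solutionZ.
by apply: periodic_solutionZ => //; exact: cS1.
Qed.

Lemma green_bounds : exists c C, [/\ 0 < c, 0 < C &
  forall f x, continuous f -> periodic f L -> (forall y, 0 <= f y) ->
  c * I f <= green f x <= C * I f].
Proof.
have [d1 [D1 [d10 D10 H1]]] := constant_solver_bounds w1.
have [d2 [D2 [d20 D20 H2]]] := constant_solver_bounds w2.
exists (d2 * d1 * L), (D2 * D1 * L); split; [by rewrite !mulr_gt0..|].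
move=> f x cf pf f0.
have B y : d1 * I f <= S1 f y <= D1 * I f.
  by have := H1 f y cf pf f0; rewrite gtr0_sg ?subr_gt0// mul1r.
have If0 : 0 <= I f by apply: primitive_ge0 => //; exact: ltW.
have S10 y : 0 <= S1 f y.
  by have /andP[h _] := B y; apply: le_trans h; rewrite mulr_ge0// ltW.
have := H2 (S1 f) x (cS1 cf) (pS1 cf pf) S10.
rewrite ltr0_sg ?oppr_lt0 ?addr_gt0 ?(lt_trans l0 lm)// mulN1r -/(S2 (S1 f) x) -/(green f x).
have h1 : d1 * I f * L <= I (S1 f).
  rewrite -(primitive_cst (d1 * I f)); apply: le_primitive => //; [exact:
      continuous_fun_cst|exact: cS1|exact: ltW|].
  by move=> y _; have /andP[] := B y.
have h2 : I (S1 f) <= D1 * I f * L.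
  rewrite -(primitive_cst (D1 * I f)); apply: le_primitive => //; [exact: cS1|exact:
      continuous_fun_cst|exact: ltW|].
  by move=> y _; have /andP[] := B y.
move=> /andP[g1 g2]; apply/andP; split.
  by apply: le_trans g1; have := ler_wpM2l (ltW d20) h1; lra.
by apply: le_trans g2 _; have := ler_wpM2l (ltW D20) h2; lra.
Qed.

Lemma green_le f g x : continuous f -> continuous g -> periodic f L -> periodic g L ->
  (forall y, f y <= g y) -> green f x <= green g x.
Proof.
move=> cf cg pf pg fg; have [c [C [c0 _ B]]] := green_bounds.
have cf1 : continuous (fun y => -1 * f y) by continuity.
have ch := continuous_funD cg cf1.
have ph : periodic (fun y => g y + -1 * f y) L by move=> y; rewrite pf pg.
have h0 y : 0 <= g y + -1 * f y by rewrite mulN1r subr_ge0.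
have /andP[H _] := B _ x ch ph h0.
have : 0 <= green (fun y => g y + -1 * f y) x.
  by apply: le_trans H; rewrite mulr_ge0 ?(ltW c0)// primitive_ge0// ltW.
by rewrite (greenD x cg cf1) (greenZ (-1) x cf) mulN1r subr_ge0.
Qed.

Lemma green_cst x : green (fun=> m ^+ 2 - l ^+ 2) x = 1.
Proof.
rewrite /green (_ : S1 _ = fun=> m + l); last first.
  by apply/funext => y; rewrite /S1 /V1 (constant_solver_cst w1); field.
by rewrite /S2 /V2 (constant_solver_cst w2); field; move: w2; rewrite oppr_eq0.
Qed.

Lemma green_derive f x : continuous f ->
  is_derive x (1 : R) (green f) (S1 f x - (m + l) * green f x).
Proof.
move=> cf; apply: is_derive_eq (is_derive_funN (periodic_solution_derive c2 i2 x (cS1 cf))) _.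
by rewrite /green /S2 /V2; ring.
Qed.

Lemma green_derive2 f x : continuous f ->
  is_derive x (1 : R) (fun y => S1 f y - (m + l) * green f y)
    ((m ^+ 2 - l ^+ 2) * green f x - 2 * l * (S1 f x - (m + l) * green f x) - f x).
Proof.
move=> cf.
apply: is_derive_eq (is_derive_funD (periodic_solution_derive c1 i1 x cf) (is_derive_funN
    (is_derive_funZ (m + l) (green_derive x cf)))) _.
by rewrite /S1 /V1; ring.
Qed.

Lemma periodic_min f : continuous f -> periodic f L -> exists x0, forall x, f x0 <= f x.
Proof.
move=> cf pf; have cn : {within `[0, L], continuous f} by exact: continuous_subspaceT.
have [x0 _ H] := EVT_min (ltW L0) cn; exists x0 => x.
by have [y yL ->//] := periodic_segment x L0; apply: H; rewrite in_itv.
Qed.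

(** Touching argument: with [n] the minimum of [q2 / q1], [n q1 <= q2] with equality at [x0].
    Monotonicity of [green], evaluated at [x0], compares the eigenvalues. *)
Lemma green_comparison (a1 a2 q1 q2 : R -> R) (r1 r2 theta : R) : 0 < theta ->
  continuous a1 -> periodic a1 L -> continuous a2 -> periodic a2 L ->
  continuous q1 -> periodic q1 L -> continuous q2 -> periodic q2 L ->
  (forall x, 0 <= a2 x) -> (forall x, a1 x <= theta * a2 x) ->
  (forall x, 0 < q1 x) -> (forall x, 0 < q2 x) ->
  (forall x, green (fun y => a1 y * q1 y) x = r1 * q1 x) ->
  (forall x, green (fun y => a2 y * q2 y) x = r2 * q2 x) -> r1 <= theta * r2.
Proof.
move=> t0 ca1 pa1 ca2 pa2 cp1 pp1 cp2 pp2 a20 a12 p10 p20 E1 E2.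
have cq : continuous (fun x => q2 x * (q1 x)^-1).
  by apply: continuous_funM => //; apply: continuous_funV => // x; rewrite gt_eqF.
have pq : periodic (fun x => q2 x * (q1 x)^-1) L by move=> x; rewrite pp1 pp2.
have [x0 H] := periodic_min cq pq; set n := q2 x0 * (q1 x0)^-1 in H.
have n0 : 0 < n by rewrite /n divr_gt0.
have cap1 : continuous (fun y => a1 y * q1 y) by continuity.
have cap2 : continuous (fun y => a2 y * q2 y) by continuity.
have : green (fun y => n * (a1 y * q1 y)) x0 <= green (fun y => theta * (a2 y * q2 y)) x0.
  apply: green_le.
  - by apply: continuous_funM => //; exact: continuous_fun_cst.
  - by apply: continuous_funM => //; exact: continuous_fun_cst.
  - by move=> y; rewrite pa1 pp1.
  - by move=> y; rewrite pa2 pp2.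
  move=> y; have np : n * q1 y <= q2 y by have := H y; rewrite ler_pdivlMr.
  apply: (@le_trans _ _ (theta * a2 y * (n * q1 y))).
    by rewrite mulrCA ler_wpM2r// mulr_ge0// ltW.
  by rewrite -mulrA ler_wpM2l ?(ltW t0)// ler_wpM2l.
rewrite (greenZ n x0 cap1) (greenZ theta x0 cap2) E1 E2.
have -> : n * (r1 * q1 x0) = r1 * q2 x0 by rewrite /n; field; rewrite gt_eqF.
by rewrite mulrA ler_pM2r.
Qed.

End green.

Lemma continuous_locally_integrable f : continuous f -> locally_integrable setT f.
Proof.
move=> cf; split; [exact: continuous_measurable|exact: openT|move=> K _ cK].
have /integrableP[] : mu.-integrable K (EFin \o f) by
  apply: continuous_compact_integrable => //; exact: continuous_subspaceT.
by [].
Qed.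

(** With [k = - t], adding [(m^2 - l^2) psi] to both sides turns the equation into
    [psi = green ((b + m^2 - t) psi)]. The Perron root [r t] of this operator is continuous in [t],
    at least 1 at [t = l^2] and at most 1 at [t = B + l^2]; a value of [t] with root 1 gives the
    eigenvalue. *)
Lemma principal_eigenvalue_exists b l : continuous b -> periodic b L -> (forall x, 0 <= b x) ->
  0 < l -> exists k, is_principal_eigenvalue L l b k.
Proof.
move=> cb pb b0 l0.
have [x1 Hx1] := periodic_min (continuous_funN cb) (fun x => congr1 -%R (pb x)).
pose B := b x1; have bB x : b x <= B by have := Hx1 x; rewrite lerN2.
(* Large enough for [l < m] and [m^2 >= B + l^2 + 1], so that the coefficient [a t] stays above
   1. *)
pose m := 1 + B + l.
have B0 : 0 <= B by exact: b0.
have lm : l < m by rewrite /m; lra.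
have mB : B + l ^+ 2 + 1 <= m ^+ 2.
  have h1 := mulr_ge0 B0 (ltW l0); have h2 := mulr_ge0 B0 B0; have h3 := mulr_ge0 (ltW l0) (ltW l0).
  by rewrite /m !expr2; lra.
(* Clamping [t] to the relevant interval gives bounds on [a t] for all real [t], so [r] is defined
   and continuous on the whole line. *)
pose cl (t : R) := Num.max (l ^+ 2) (Num.min t (B + l ^+ 2)).
have cl_bd t : l ^+ 2 <= cl t <= B + l ^+ 2.
  by rewrite /cl le_max lexx/= ge_max lerDr B0 ge_min lexx orbT.
pose a t x := b x + (m ^+ 2 - cl t).
have a1 t x : 1 <= a t x.
  by have := b0 x; have := cl_bd t; rewrite /a => /andP[]; lra.
have ca t : continuous (a t) by apply: continuous_funD => //; exact: continuous_fun_cst.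
have pa t : periodic (a t) L by move=> x; rewrite /a pb.
have aM t x : a t x <= m ^+ 2 + B by have := bB x; have := cl_bd t; have := sqr_ge0 l; rewrite /a
    => ? /andP[]; lra.
have [d [D [d0 D0 GB]]] := green_bounds l0 lm.
have perron t : exists pr : (R -> R) * R, [/\ continuous pr.1, periodic pr.1 L,
    forall x, 0 < pr.1 x, 0 < pr.2 & forall x, green l m (fun y => a t y * pr.1 y) x = pr.2 *
        pr.1 x].
  pose T f := green l m (fun y => a t y * f y).
  have cT f : continuous f -> continuous (fun y => a t y * f y) by move=> cf; exact:
      continuous_funM.
  have pT f : periodic f L -> periodic (fun y => a t y * f y) L by move=> pf y; rewrite pf pa.
  have M0 : 0 < m ^+ 2 + B by apply: lt_le_trans (aM t 0); exact: lt_le_trans ltr01 (a1 t 0).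
  have TB f x : continuous f -> periodic f L -> (forall y, 0 <= f y) ->
      d * I f <= T f x <= (D * (m ^+ 2 + B)) * I f.
    move=> cf pf f0; have af0 y : 0 <= a t y * f y by rewrite mulr_ge0// (le_trans ler01).
    have /andP[h1 h2] := GB _ x (cT _ cf) (pT _ pf) af0; apply/andP; split.
      apply: le_trans h1; rewrite ler_wpM2l ?(ltW d0)//; apply: le_primitive => //; [exact:
          cT|exact: ltW|].
      by move=> y _; rewrite -[leLHS]mul1r ler_wpM2r.
    apply: le_trans h2 _; rewrite -mulrA ler_wpM2l ?(ltW D0)// -primitiveZ//.
    apply: le_primitive => //; [exact: cT|by apply: continuous_funM => //; exact:
        continuous_fun_cst|exact: ltW|].
    by move=> y _; rewrite ler_wpM2r.
  have [//||||psi [r H]] := @perron_eigenfunction R L L0 T d (D * (m ^+ 2 + B)) d0 (mulr_gt0 D0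
      M0) _ _ _ _ TB.
  - by move=> f cf pf; exact: (green_continuous l0 lm (cT _ cf)).
  - by move=> f cf pf; exact: (green_periodic l0 lm (cT _ cf) (pT _ pf)).
  - move=> f g x cf cg _ _.
    rewrite /T (_ : (fun y => _) = fun y => a t y * f y + a t y * g y).
      exact: (greenD l0 lm x (cT _ cf) (cT _ cg)).
    by apply/funext => y; rewrite mulrDr.
  - move=> e f x cf _; rewrite /T (_ : (fun y => _) = fun y => e * (a t y * f y)).
      exact: (greenZ l0 lm e x (cT _ cf)).
    by apply/funext => y; rewrite mulrCA.
  by exists (psi, r).
have [pr prP] := choice perron; pose r t := (pr t).2.
have r0 t : 0 < r t by have [] := prP t.
have cmp s t theta : 0 < theta -> (forall x, a s x <= theta * a t x) -> r s <= theta * r t.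
  move=> th0 ast; have [cs ps s0 _ Es] := prP s; have [ct pt t0 _ Et] := prP t.
  apply: (green_comparison l0 lm th0 (ca s) (pa s) (ca t) (pa t) cs ps ct pt _ ast s0 t0 Es Et).
  by move=> x; exact: le_trans ler01 (a1 t x).
have minr_lip (c s t : R) : `|Num.min s c - Num.min t c| <= `|s - t|.
  have := ler_norm (s - t); have := ler_norm (t - s); rewrite (distrC t s) => h1 h2.
  by rewrite ler_norml; case: (leP s c); case: (leP t c) => *; apply/andP; split; lra.
have maxr_lip (c s t : R) : `|Num.max c s - Num.max c t| <= `|s - t|.
  have := ler_norm (s - t); have := ler_norm (t - s); rewrite (distrC t s) => h1 h2.
  by rewrite ler_norml; case: (leP c s); case: (leP c t) => *; apply/andP; split; lra.
have cl_lip s t : `|cl s - cl t| <= `|s - t| by exact: le_trans (maxr_lip _ _ _) (minr_lip _ _ _).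
(* As [a t >= 1], the additive change of the coefficient is dominated by a multiplicative one. *)
have r_lip s t : r s <= (1 + `|s - t|) * r t.
  apply: cmp; first by rewrite ltr_pwDl.
  move=> x; rewrite mulrDl mul1r; have h1 := cl_lip s t; have h2 := a1 t x.
  have : `|s - t| <= `|s - t| * a t x by rewrite -[leLHS]mulr1 ler_wpM2l.
  by move: h1; rewrite ler_norml /a => /andP[]; lra.
have rmax t : r t <= (1 + (m ^+ 2 + B)) * r 0.
  apply: cmp; first by rewrite addrC ltr_wpDl// addr_ge0// sqr_ge0.
  move=> x; apply: le_trans (aM t x) _; rewrite -[leLHS]mulr1; apply: ler_pM => //.
    by rewrite addr_ge0// sqr_ge0.
  by rewrite lerDr.
set rM := (1 + _) * r 0 in rmax.
have rM0 : 0 < rM by exact: lt_le_trans (r0 0) (rmax 0).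
have cr : continuous r.
  move=> s; apply/cvgrPdist_le => e e0; near=> t.
  have h1 := r_lip s t; have h2 := r_lip t s; rewrite distrC in h2.
  have h3 : `|s - t| * rM <= e.
    by rewrite -ler_pdivlMr//; near: t; apply: cvgr_dist_le; rewrite ?divr_gt0//; exact: cvg_id.
  have h4 := ler_wpM2l (normr_ge0 (s - t)) (rmax s).
  have h5 := ler_wpM2l (normr_ge0 (s - t)) (rmax t).
  by rewrite ler_norml; apply/andP; split; lra.
have cst_ev : forall x : R, green l m (fun y => (m ^+ 2 - l ^+ 2) * 1) x = 1 * 1.
  by move=> x; rewrite mulr1 [RHS]mulr1 (green_cst l0 lm).
have pc (c : R) : periodic (fun _ : R => c) L by [].
have ml0 : 0 <= m ^+ 2 - l ^+ 2 by lra.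
have clo : cl (l ^+ 2) = l ^+ 2.
  by rewrite /cl min_l ?max_l// lerDr.
have chi : cl (B + l ^+ 2) = B + l ^+ 2.
  by rewrite /cl min_l ?max_r// lerDr.
(* At both ends of the interval, [a] is compared with the constant [m^2 - l^2], for which the
   function 1 has eigenvalue 1. *)
have rlo : 1 <= r (l ^+ 2).
  have [cs ps s0 _ Es] := prP (l ^+ 2).
  have := green_comparison l0 lm ltr01 (@continuous_fun_cst _ _) (pc _) (ca (l ^+ 2)) (pa _)
      (@continuous_fun_cst _ 1) (pc _) cs ps
    _ _ (fun=> ltr01) s0 cst_ev Es.
  rewrite mul1r; apply.
    by move=> x; exact: le_trans ler01 (a1 _ x).
  by move=> x; rewrite mul1r /a clo lerDr.
have rhi : r (B + l ^+ 2) <= 1.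
  have [cs ps s0 _ Es] := prP (B + l ^+ 2).
  have := green_comparison l0 lm ltr01 (ca (B + l ^+ 2)) (pa _) (@continuous_fun_cst _ _) (pc _)
      cs ps (@continuous_fun_cst _ 1) (pc _)
    (fun=> ml0) _ s0 (fun=> ltr01) Es cst_ev.
  by rewrite !mul1r; apply => x; rewrite /a chi; have := bB x; lra.
have lB : l ^+ 2 <= B + l ^+ 2 by rewrite lerDr.
have [] := @IVT _ r _ _ 1 lB (continuous_subspaceT cr).
  by rewrite ge_min le_max rlo rhi orbT.
move=> t _ rt1; have [cp pp p0 _ Ep] := prP t; set psi := (pr t).1 in cp pp p0 Ep.
rewrite -/(r t) rt1 in Ep; exists (- cl t).
have cap : continuous (fun y => a t y * psi y) by exact: continuous_funM.
(* Perron root 1 makes [psi] a fixed point of the inverse operator, hence twice differentiable and a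
   solution with [k = - cl t]. *)
have psiE : psi = green l m (fun y => a t y * psi y).
  by apply/funext => x; rewrite Ep mul1r.
pose psi' x := periodic_solution L (fun=> m - l) (fun y => a t y * psi y) x - (m + l) * psi x.
pose psi'' x := (m ^+ 2 - l ^+ 2) * psi x - 2 * l * psi' x - a t x * psi x.
have dpsi x : is_derive x (1 : R) psi (psi' x).
  by rewrite /psi' {1 3}psiE; exact: (green_derive l0 lm x cap).
have dpsi' x : is_derive x (1 : R) psi' (psi'' x).
  rewrite (_ : psi' = fun y => periodic_solution L (fun=> m - l) (fun y => a t y * psi y) y - (m
      + l) * green l m (fun y => a t y * psi y) y).
    apply: is_derive_eq (green_derive2 l0 lm x cap) _.
    by rewrite -psiE.
  by rewrite -psiE.
have cpsi' : continuous psi' := is_derive_continuous dpsi'.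
have cpsi'' : continuous psi'' by have cat := ca t; rewrite /psi''; continuity.
have D1 : derive1 psi = psi' by apply/funext => x; rewrite derive1E; exact: derive_val.
exists psi, psi''; split => //.
- split; first exact: continuous_locally_integrable.
  move=> x y xy; rewrite D1 Rintegral_primitive// !(primitive_unique _ cpsi'' dpsi'); ring.
- by apply: aeW => x; rewrite D1 /psi'' /a; ring.
Unshelve. all: by end_near. Qed.

End existence.

(** * Minimal speed and maximizers *)

Section minimal_speed.
Context {R : realType}.
Implicit Types (f g b v : R -> R) (x l k c L : R).

Local Notation mu := (@lebesgue_measure R).

Lemma principal_eigenvalueP L l b : (exists k, is_principal_eigenvalue L l b k) ->
  is_principal_eigenvalue L l b (principal_eigenvalue L l b).
Proof. exact: xgetPex. Qed.

(** [xget] falls back on 0 when there is no eigenvalue, so any other value certifies existence. *)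
Lemma principal_eigenvalue_neq0 L l b : principal_eigenvalue L l b != 0 ->
  is_principal_eigenvalue L l b (principal_eigenvalue L l b).
Proof.
move=> k0; apply: principal_eigenvalueP; apply: contrapT => H.
move: k0; rewrite /principal_eigenvalue xgetPN ?eqxx// => k Hk.
by apply: H; exists k.
Qed.

Lemma minimal_speedP L b : (exists c, speeds L b c /\ lbound (speeds L b) c) ->
  speeds L b (minimal_speed L b) /\ lbound (speeds L b) (minimal_speed L b).
Proof. by move=> H; exact: (xgetPex 0 H). Qed.

Lemma minimal_speed_neq0 L b : minimal_speed L b != 0 ->
  speeds L b (minimal_speed L b) /\ lbound (speeds L b) (minimal_speed L b).
Proof.
move=> c0; apply: minimal_speedP; apply: contrapT => H.
move: c0; rewrite /minimal_speed xgetPN ?eqxx// => c Hc.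
by apply: H; exists c.
Qed.

(** [m l / l] is continuous by the Lipschitz bound on [m], and [m l >= a + l^2] with [a > 0] makes
    it positive and large both near 0 and at infinity, so a minimum is attained. *)
Lemma minimal_speed_attained L b : 0 < L -> continuous b -> periodic b L -> (forall x, 0 < b x) ->
  0 < minimal_speed L b /\
  exists l v, 0 < l /\ weak_riccati L b (minimal_speed L b * l) l v.
Proof.
move=> L0 cb pb b0; pose m l := - principal_eigenvalue L l b.
have Rv l : 0 < l -> exists v, weak_riccati L b (m l) l v.
  move=> l0; have [v Hv _] := principal_eigenvalue_riccati L0 (continuous_locally_integrable cb)
    (principal_eigenvalueP (principal_eigenvalue_exists L0 cb pb (fun x => ltW (b0 x)) l0)).
  by exists v.
have mono l1 l2 : 0 < l1 -> l1 <= l2 -> m l1 <= m l2.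
  move=> l10 l12; have l20 := lt_le_trans l10 l12.
  have [v1 R1] := Rv _ l10; have [v2 R2] := Rv _ l20.
  by apply: (riccati_mono L0 l10 l20 R1 R2 (M := Num.max (m l1) (m l2))) => //;
     rewrite le_max lexx ?orbT.
pose a := \int[mu]_(x in `[0, L]) b x / L.
have a0 : 0 < a.
  by rewrite /a -primitive_Rintegral ?(ltW L0)// divr_gt0// primitive_gt0.
have mlow l : 0 < l -> a + l ^+ 2 <= m l.
  by move=> l0; have [v Hv] := Rv _ l0; exact: (riccati_lower_bound L0 Hv).
pose F l := m l / l.
have F1 : 0 < F 1 by rewrite /F divr1; apply: lt_le_trans (mlow 1 ltr01); rewrite addr_gt0//
    exprn_gt0.
(* Below [lo], [F l >= a / l >= F 1]; above [hi], [F l >= l >= F 1]. Including 1 in the segment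
   makes its minimum global. *)
pose lo := Num.min 1 (a / F 1); pose hi := Num.max 1 (F 1).
have lo0 : 0 < lo by rewrite lt_min ltr01 divr_gt0.
have lo1 : lo <= 1 by rewrite ge_min lexx.
have hi1 : 1 <= hi by rewrite le_max lexx.
have lohi := le_trans lo1 hi1.
have cF l : 0 < l -> {for l, continuous F}.
  move=> l0; suff cm : {for l, continuous m} by apply: cvgM => //; apply: cvgV; [rewrite
      gt_eqF|exact: cvg_id].
  pose K := expR (L * (1 + 2 * m (2 * l)) - 2 * \int[mu]_(x in `[0, L]) b x) / L.
  have K0 : 0 < K by rewrite divr_gt0// expR_gt0.
  apply/cvgrPdist_le => e e0; near=> t.
  have t0 : 0 < t by near: t; exact: lt_nbhsr.
  have tl : t < 2 * l by near: t; apply: lt_nbhsl; lra.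
  have [v1 R1] := Rv _ l0; have [v2 R2] := Rv _ t0.
  have m1 : m l <= m (2 * l) by apply: mono => //; lra.
  have m2 : m t <= m (2 * l) by apply: mono => //; exact: ltW.
  have := riccati_lipschitz L0 l0 t0 R1 R2 m1 m2; rewrite -/K => /le_trans; apply.
  rewrite -ler_pdivlMr//; near: t; apply: cvgr_dist_le; last exact: divr_gt0.
  exact: cvg_id.
have cw : {within `[lo, hi], continuous F}.
  apply: continuous_in_subspaceT => l; rewrite inE/= in_itv/= => /andP[ll _].
  by apply: cF; exact: lt_le_trans ll.
have [l1 l1in Fmin] := EVT_min lohi cw.
have l10 : 0 < l1 by move: l1in; rewrite in_itv/= => /andP[/(lt_le_trans lo0)].
have F_le l : 0 < l -> F l1 <= F l.
  move=> l0; have F11 : F l1 <= F 1 by apply: Fmin; rewrite in_itv/= lo1 hi1.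
  have [lol|lol] := leP lo l; last first.
    apply: le_trans F11 _; rewrite ler_pdivlMr//; apply: le_trans (mlow _ l0).
    apply: (@le_trans _ _ a); last by rewrite lerDl sqr_ge0.
    rewrite mulrC -ler_pdivlMr//; apply: le_trans (ltW lol) _.
    by rewrite ge_min lexx orbT.
  have [lhi|lhi] := leP l hi; first by apply: Fmin; rewrite in_itv/= lol.
  apply: le_trans F11 _; rewrite ler_pdivlMr//; apply: le_trans (mlow _ l0).
  apply: (@le_trans _ _ (l * l)); last by rewrite -expr2 lerDr ltW.
  rewrite ler_wpM2r ?(ltW l0)//; apply: le_trans (ltW lhi).
  by rewrite le_max lexx orbT.
have [[l2 /= l20 El2] _] : speeds L b (minimal_speed L b) /\ lbound (speeds L b) (minimal_speed L
    b).
  apply: minimal_speedP; exists (F l1); split; first by exists l1.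
  by move=> _ [l /= l0 <-]; exact: F_le.
rewrite -/(m l2) -/(F l2) in El2.
have ml2 : m l2 = minimal_speed L b * l2 by rewrite -El2 divfK// gt_eqF.
split; last by have [v Hv] := Rv _ l20; exists l2, v; rewrite -ml2.
rewrite -El2 divr_gt0//; apply: lt_le_trans (mlow _ l20).
by rewrite ltr_wpDr// sqr_ge0.
Unshelve. all: by end_near. Qed.

Lemma A2_continuous L beta f : 0 < L -> continuous f -> periodic f L -> (forall x, 0 <= f x) ->
  primitive (fun x => f x ^+ 2) L = beta * L -> A2 L beta f.
Proof.
move=> L0 cf pf f0 fL; have cf2 : continuous (fun x => f x ^+ 2) by continuity.
split; [exact: continuous_locally_integrable|exact: aeW|exact: aeW|].
have -> : (\int[mu]_(x in `[0%R, L]) ((f x) ^+ 2)%:E)%E = (beta * L)%:E.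
  rewrite -fL primitive_Rintegral ?(ltW L0)// /Rintegral fineK//.
  exact: (integrable_fin_num _ (continuous_integrable _ _ cf2)).
by rewrite -EFinM mulrC mulfK// gt_eqF.
Qed.

Lemma A2_sqr_integrable L beta b : 0 < L -> A2 L beta b ->
  mu.-integrable `[0, L] (EFin \o (fun x => b x ^+ 2)) /\
  \int[mu]_(x in `[0, L]) b x ^+ 2 = beta * L.
Proof.
move=> L0 [[mb _ _] _ _ E].
have {}E : (\int[mu]_(x in `[0%R, L]) ((b x) ^+ 2)%:E)%E = (beta * L)%:E.
  rewrite mulrC EFinM -E muleA -EFinM divff ?mul1e// gt_eqF//.
split; last by rewrite /Rintegral E.
apply/integrableP; split.
  apply/measurable_EFinP; apply: measurable_funX.
  exact: (@measurable_funS _ _ _ _ setT).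
under eq_integral do rewrite /= ger0_norm ?sqr_ge0//.
by rewrite E ltry.
Qed.

End minimal_speed.

(** * Equality in Cauchy-Schwarz and the first integral *)

Section maximizer.
Context {R : realType}.

Local Notation mu := (@lebesgue_measure R).

Lemma Rintegral_sqr_eq0 (f : R -> R) (a b : R) : mu.-integrable `[a, b] (EFin \o (fun x => f x ^+
    2)) ->
  \int[mu]_(x in `[a, b]) f x ^+ 2 <= 0 -> {ae mu, forall x, a <= x <= b -> f x = 0}.
Proof.
pose g x := (f x ^+ 2)%:E.
move=> fi I0; have mf : measurable_fun `[a, b] g by case/integrableP: fi.
have E : (\int[mu]_(x in `[a, b]) `|g x| = 0)%E.
  under eq_integral do rewrite /g /= ger0_norm ?sqr_ge0//.
  apply/le_anti/andP; split; last by apply: integral_ge0 => x _; rewrite lee_fin sqr_ge0.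
  rewrite -[leLHS]fineK; first by rewrite lee_fin.
  exact: (integrable_fin_num _ fi).
have ae0 : {ae mu, forall x, [set` `[a, b]] x -> g x = 0%E}.
  by apply/(ae_eq_integral_abs mu _ mf).
apply: filterS ae0; first exact: (ae_filter_ringOfSetsType mu).
move=> x /= H xab; have : g x = 0%E by apply: H; rewrite in_itv.
by rewrite /g => -[] /eqP; rewrite sqrf_eq0 => /eqP.
Qed.

(** [t] gives [t p] the same square integral [beta * L] as [b]. Expanding the integral of
    [(b - t p)^2] then shows that it is at most 0. *)
Lemma maximizer_proportional (L beta : R) (b p : R -> R) : 0 < L -> 0 < beta -> A2 L beta b ->
  continuous p -> periodic p L -> (forall x, 0 < p x) ->
  let t := Num.sqrt (beta * L / primitive (fun x => p x ^+ 2) L) in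
  t * primitive (fun x => p x ^+ 2) L <= \int[mu]_(x in `[0, L]) (b x * p x) ->
  {ae mu, forall x, 0 <= x <= L -> b x = t * p x}.
Proof.
move=> L0 beta0 Ab cp pp p0 t H; have [lb _ _ _] := Ab.
have [b2i b2E] := A2_sqr_integrable L0 Ab.
have cp2 : continuous (fun x => p x ^+ 2) by continuity.
have P0 : 0 < primitive (fun x => p x ^+ 2) L by apply: primitive_gt0 => // x; rewrite exprn_gt0.
have t2 : t ^+ 2 * primitive (fun x => p x ^+ 2) L = beta * L.
  by rewrite sqr_sqrtr ?divfK ?gt_eqF// divr_ge0 ?mulr_ge0// ltW.
have t0 : 0 <= t by exact: sqrtr_ge0.
have bpi : mu.-integrable `[0, L] (EFin \o (fun x => b x * p x)).
  by apply: integrable_mul_continuous => //; exact: locally_integrable_itv.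
have ctp : continuous (fun x => t ^+ 2 * p x ^+ 2) by continuity.
have j1 : mu.-integrable `[0, L] (EFin \o (fun x => - (2 * t) * (b x * p x))).
  exact: (integrableZl _ _ bpi).
have j2 := continuous_integrable 0 L ctp.
have j3 : mu.-integrable `[0, L] (EFin \o (fun x => b x ^+ 2 + - (2 * t) * (b x * p x))).
  exact: (integrableD _ b2i j1).
have j4 : mu.-integrable `[0, L] (EFin \o (fun x => b x ^+ 2 + - (2 * t) * (b x * p x) + t ^+ 2 *
    p x ^+ 2)).
  exact: (integrableD _ j3 j2).
have sq : (fun x => b x ^+ 2 + - (2 * t) * (b x * p x) + t ^+ 2 * p x ^+ 2) = (fun x => (b x - t
    * p x) ^+ 2).
  by apply/funext => x; ring.
have : {ae mu, forall x, 0 <= x <= L -> b x - t * p x = 0}.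
  apply: Rintegral_sqr_eq0; first by rewrite -sq.
  have E1 : \int[mu]_(x in `[0, L]) (- (2 * t) * (b x * p x)) =
      - (2 * t) * \int[mu]_(x in `[0, L]) (b x * p x) by exact: RintegralZl.
  have E2 : \int[mu]_(x in `[0, L]) (t ^+ 2 * p x ^+ 2) = beta * L.
    by rewrite -primitive_Rintegral ?(ltW L0)// primitiveZ.
  rewrite -sq RintegralD// RintegralD// b2E E1 E2.
  by have := ler_wpM2l t0 H; rewrite mulrA -expr2 t2; lra.
apply: filterS; first exact: (ae_filter_ringOfSetsType mu).
by move=> x E xL; apply/eqP; rewrite -subr_eq0; apply/eqP/E.
Qed.

(** The left-hand side [Q] has zero derivative along the system for [p] and [v]; its constant value
    is its mean, to which [B''] contributes nothing by periodicity. *)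
Lemma weighted_riccati_euler_lagrange (L k t : R) (v : R -> R) lambda : 0 < L -> 0 < lambda ->
  continuous v -> periodic v L -> primitive v L = lambda * L ->
  let B := fun x => t * riccati_weight L v x in
  (forall x, is_derive x (1 : R) v (- k - B x - v x ^+ 2)) ->
  exists B' B'' : R -> R, [/\ forall x, is_derive x (1 : R) B (B' x),
    forall x, is_derive x (1 : R) B' (B'' x) &
    forall x, B'' x + 4 * k * B x + 3 * B x ^+ 2 =
      3 * (primitive (fun x => B x ^+ 2) L / L) + 4 * k / L * primitive B L].
Proof.
move=> L0 l0 cv pv vl B dv; set p := riccati_weight L v in B dv *.
have dp : forall x, is_derive x (1 : R) p (2 * v x * p x - 1) by exact: (riccati_weight_derive L0
    cv vl l0).
have pp : periodic p L by exact: (riccati_weight_periodic L0 cv pv vl l0).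
have cp : continuous p := is_derive_continuous dp.
pose B' x := t * (2 * v x * p x - 1).
pose B'' x := t * (2 * (- k - B x - v x ^+ 2) * p x + 2 * v x * (2 * v x * p x - 1)).
have dB x : is_derive x (1 : R) B (B' x) by exact: is_derive_funZ.
have dB' x : is_derive x (1 : R) B' (B'' x).
  apply: is_derive_eq (is_derive_funZ t (is_derive_funD (is_derive_funM (is_derive_funZ 2 (dv x))
      (dp x)) (is_derive_fun_cst x (-1)))) _.
  by rewrite /B''; ring.
have cB : continuous B := is_derive_continuous dB.
have cB' : continuous B' := is_derive_continuous dB'.
have cB'' : continuous B'' by rewrite /B''; continuity.
have pB' : periodic B' L by move=> x; rewrite /B' pv pp.
pose Q x := B'' x + 4 * k * B x + 3 * B x ^+ 2.
(* As a polynomial in [p] and [v], [Q] is differentiated using only their first-order equations. *)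
have QE : Q = fun x => t * (2 * k * p x + t * (p x * p x) + 2 * (v x * v x * p x) + (- 2) * v x).
  by apply/funext => x; rewrite /Q /B'' /B; ring.
have dQ x : is_derive x (1 : R) Q 0.
  rewrite QE.
  have d1 := is_derive_funZ (2 * k) (dp x).
  have d2 := is_derive_funZ t (is_derive_funM (dp x) (dp x)).
  have d3 := is_derive_funZ 2 (is_derive_funM (is_derive_funM (dv x) (dv x)) (dp x)).
  have d4 := is_derive_funZ (- 2) (dv x).
  apply: is_derive_eq (is_derive_funZ t (is_derive_funD (is_derive_funD (is_derive_funD d1 d2)
      d3) d4)) _.
  by rewrite /B; ring.
exists B', B''; split=> // x; rewrite -/(Q x).
have : primitive Q L = Q x * L.
  rewrite -primitive_cst; congr (primitive _ L); apply/funext => y.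
  exact: is_derive0_constant.
rewrite /Q !primitiveD; try by continuity.
rewrite (primitive_derivative cB'' dB' pB') primitiveZ// primitiveZ; last by continuity.
rewrite add0r => E; apply: (mulIf (x := L)); first by rewrite gt_eqF.
by rewrite -E; field; rewrite gt_eqF.
Qed.

End maximizer.

(** * Euler-Lagrange equation for a maximizer *)

Theorem theorem2p4 (R : realType) (L beta : R) (hL : 0 < L) (hbeta : 0 < beta)
    (b : R -> R) (hb : is_maximizer_A2 L beta b) :
  let k := principal_eigenvalue L (optimal_lambda L b) b in
  let C := 3 * beta
           + 4 * k / L * \int[@lebesgue_measure R]_(x in `[0, L]) b x in
  exists B : R -> R,
    [/\ {ae @lebesgue_measure R, forall x, B x = b x},
        periodic B L,
        forall x, derivable B x 1,
        forall x, derivable (derive1 B) x 1 &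
        forall x, derive1 (derive1 B) x + 4 * k * B x + 3 * B x ^+ 2 = C].
Proof.
move=> k C; have [Ab maxb] := hb; have [lb _ _ _] := Ab.
pose c := minimal_speed L b.
(* The constant [Num.sqrt beta] is a competitor of positive speed, so [c] is not the default value
   0. *)
have c0 : 0 < c.
  have s0 : 0 < Num.sqrt beta by rewrite sqrtr_gt0.
  have cs := @continuous_fun_cst R (Num.sqrt beta).
  have ps : periodic (fun _ : R => Num.sqrt beta) L by [].
  have [h _] := minimal_speed_attained hL cs ps (fun=> s0).
  apply: lt_le_trans h (maxb _ _); apply: A2_continuous => //.
  by rewrite sqr_sqrtr ?(ltW hbeta)// primitive_cst.
have [[l1 /= l10 El1] lbc] := minimal_speed_neq0 (lt0r_neq0 c0).
rewrite -/c in El1 lbc.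
pose l0 := optimal_lambda L b.
(* [l1] inhabits the set defining [optimal_lambda], so [l0] is a genuine minimizer. *)
have [l00 El0] : 0 < l0 /\ - k / l0 = c.
  by apply: (xgetPex 0 (P := [set l | 0 < l /\ - principal_eigenvalue L l b / l = c])); exists l1.
pose m l := - principal_eigenvalue L l b.
have cm l : 0 < l -> c * l <= m l.
  by move=> l_0; rewrite -ler_pdivlMr//; apply: lbc; exists l.
have ml0 : m l0 = c * l0 by rewrite -El0 divfK// gt_eqF.
(* For [l > 0], [c * l <= m l] makes the eigenvalue nonzero, hence genuine. For other [l] a dummy
   function makes the family total. *)
have Hv l : exists v, 0 < l -> weak_riccati L b (m l) l v /\
  forall B, continuous B -> periodic B L ->
    {ae @lebesgue_measure R, forall x, 0 <= x <= L -> b x = B x} ->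
    (forall x, is_derive x (1 : R) v (m l - B x - v x ^+ 2)) /\
    {ae @lebesgue_measure R, forall x, B x = b x}.
  have [l_0|l_0] := ltP 0 l; last by exists (fun=> 0).
  have kn0 : principal_eigenvalue L l b != 0.
    by rewrite -oppr_eq0 gt_eqF//; apply: lt_le_trans (cm _ l_0); rewrite mulr_gt0.
  have [v R1 R2] := principal_eigenvalue_riccati hL lb (principal_eigenvalue_neq0 kn0).
  by exists v.
have [v vP] := choice Hv; have Rv l (l_0 : 0 < l) := (vP l l_0).1.
have [cv pv vl _] := Rv _ l00.
set p := riccati_weight L (v l0).
have cp : continuous p by exact: (riccati_weight_continuous hL cv vl l00).
have pp : periodic p L by exact: (riccati_weight_periodic hL cv pv vl l00).
have p0 x : 0 < p x by exact: (riccati_weight_gt0 hL cv pv vl l00).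
have cP : c * primitive p L = L by exact: (riccati_first_order hL l00 Rv cm ml0).
pose P2 := primitive (fun x => p x ^+ 2) L; pose t := Num.sqrt (beta * L / P2).
have cp2 : continuous (fun x => p x ^+ 2) by continuity.
have P20 : 0 < P2 by apply: primitive_gt0 => // x; rewrite exprn_gt0.
have t0 : 0 < t by rewrite sqrtr_gt0 divr_gt0// mulr_gt0.
have t2 : t ^+ 2 * P2 = beta * L by rewrite sqr_sqrtr ?divfK ?gt_eqF// divr_ge0 ?mulr_ge0// ltW.
pose B x := t * p x.
have cB : continuous B by rewrite /B; continuity.
have pB : periodic B L by move=> x; rewrite /B pp.
have B0 x : 0 < B x by rewrite mulr_gt0.
have PB2 : primitive (fun x => B x ^+ 2) L = beta * L.
  rewrite -t2 -primitiveZ//; congr (primitive _ L); apply/funext => x.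
  by rewrite /B exprMn.
have AB : A2 L beta B by apply: A2_continuous => // x; exact: ltW.
have [_ [lh [vh [lh0 Rh]]]] := minimal_speed_attained hL cB pB B0.
have ch := maxb _ AB; rewrite -/c in ch.
(* In the identity between [b] and the competitor [B], maximality bounds the eigenvalue term by
   [c * lh], and [c * primitive p L = L] then cancels all terms linear in [lh] and [l0]. What
   remains is that the integral of [B p] is at most that of [b p]. *)
have bB : {ae @lebesgue_measure R, forall x, 0 <= x <= L -> b x = B x}.
  apply: maximizer_proportional => //; rewrite -/P2 -/t.
  have /= := weak_riccati_identity hL l00 (Rv _ l00) Rh; rewrite -/p ml0.
  have -> : \int[@lebesgue_measure R]_(x in `[0, L]) (B x * p x) = t * P2.
    rewrite -primitive_Rintegral ?(ltW hL)//; last by continuity.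
    rewrite /P2 -primitiveZ//; congr (primitive _ L); apply/funext => x.
    by rewrite /B expr2 mulrA.
  have cvh : continuous vh by case: Rh.
  have cv0 := cv.
  have : 0 <= primitive (fun x => (vh x - v l0 x) ^+ 2 * p x) L.
    apply: primitive_ge0; [by continuity|exact: ltW|move=> x].
    by rewrite mulr_ge0 ?sqr_ge0// ltW.
  have : minimal_speed L B * (lh * primitive p L) <= c * (lh * primitive p L).
    by rewrite ler_wpM2r// mulr_ge0 ?(ltW lh0)// primitive_ge0// ?(ltW hL)// => x; exact: ltW.
  have -> : c * (lh * primitive p L) = lh * L by rewrite mulrCA cP.
  have e2 : c * l0 * primitive p L = l0 * L by rewrite mulrAC cP mulrC.
  rewrite mulrBl e2; lra.
(* The continuous representative makes [v l0] a classical solution and extends the equality from one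
   period to the line. *)
have [dv aeB] := (vP l0 l00).2 B cB pB bB.
have {}dv x : is_derive x (1 : R) (v l0) (- k - B x - v l0 x ^+ 2) by exact: dv.
have [B' [B'' [dB dB' EL]]] := weighted_riccati_euler_lagrange hL l00 cv pv vl dv.
have D1 : derive1 B = B' by apply/funext => x; rewrite derive1E; exact: derive_val.
have D2 : derive1 B' = B'' by apply/funext => x; rewrite derive1E; exact: derive_val.
exists B; split => //.
  by move=> x; rewrite D1; case: (dB' x).
(* The mean of [B^2] is [beta]; it remains to replace the integral of [B] by that of [b]. *)
move=> x; rewrite D1 D2 EL -/p -/B PB2 mulfK ?gt_eqF// /C.
rewrite primitive_Rintegral ?(ltW hL)//; congr (_ + _ * _).
have mbL : measurable_fun `[0, L] b.
  by case: lb => mb _ _; exact: (@measurable_funS _ _ _ _ setT).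
apply: Rintegral_ae => //; first exact: continuous_measurable.
apply: filterS bB; first exact: (ae_filter_ringOfSetsType (@lebesgue_measure R)).
by move=> y /= E; rewrite in_itv/= => /E.
Qed.
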